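(* Let $M,N\ge 1$ be integers. Let $\theta_1,\dots,\theta_M$ and $\beta_1,\dots,\beta_N$ be real with $|\theta_i|\le\frac{\pi}{2}$ and $|\beta_i|\le\frac{\pi}{2}$, let $a_1,\dots,a_M,b_1,\dots,b_N$ be complex numbers, and let $x_1,\dots,x_M,y_1,\dots,y_N$ be nonzero complex numbers. Assume that for all odd natural numbers $n,k$ we have $x_i^2n^2-x_j^2k^2\ne a_j^2-a_i^2$ for all $1\le i,j\le M$, $i\neq j$, and $y_i^2n^2-y_j^2k^2\neq b_j^2-b_i^2$ for all $1\le i,j\le N$, $i\ne j$. Assume also that for each $1\le i,j\le M$, $i\ne j$, either $\operatorname{Im}(x_i/x_j)\ne0$ or $x_i=x_j$, and for each $1\le i,j\le N$, $i\neq j$, either $\operatorname{Im}(y_i/y_j)\neq 0$ or $y_i=y_j$. Let $t$ be an arbitrary complex number, and assume the parameters are such that every term below is defined, i.e. $t\neq0$ and, for all odd natural numbers $n,k$ and all $i,j$: $x_i^2n^2+a_i^2\ne 0$, $y_j^2n^2+b_j^2\neq0$, $x_i^2n^2+a_i^2\neq t^2$, $y_j^2n^2+b_j^2\neq t^{-2}$, and $(x_i^2n^2+a_i^2)(y_j^2k^2+b_j^2)\neq 1$. Write $X_{i,n}=(2n+1)^2x_i^2+a_i^2$ and $Y_{i,n}=(2n+1)^2y_i^2+b_i^2$. Then $$\sum_{i=1}^{M}x_i\sum_{n=0}^{\infty}\frac{(-1)^n\sin((2n+1)\theta_i)}{X_{i,n}-t^2}\prod_{j=1}^{N}\frac{\sinh\left(\frac{\beta_j}{y_j}\sqrt{b_j^2-\frac{1}{X_{i,n}}}\right)}{\sqrt{b_j^2-\frac{1}{X_{i,n}}}\cosh\left(\frac{\pi}{2y_j}\sqrt{b_j^2-\frac{1}{X_{i,n}}}\right)}\prod_{\substack{1\le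 j\le M\\ j\ne i}}\frac{\sin\left(\frac{\theta_j}{x_j}\sqrt{X_{i,n}-a_j^2}\right)}{\sqrt{X_{i,n}-a_j^2}\cos\left(\frac{\pi}{2x_j}\sqrt{X_{i,n}-a_j^2}\right)}$$ $$+\sum_{i=1}^{N}y_i\sum_{n=0}^{\infty}\frac{(-1)^n\sin((2n+1)\beta_i)}{Y_{i,n}\,(Y_{i,n}t^2-1)}\prod_{j=1}^{M}\frac{\sinh\left(\frac{\theta_j}{x_j}\sqrt{a_j^2-\frac{1}{Y_{i,n}}}\right)}{\sqrt{a_j^2-\frac{1}{Y_{i,n}}}\cosh\left(\frac{\pi}{2x_j}\sqrt{a_j^2-\frac{1}{Y_{i,n}}}\right)}\prod_{\substack{1\le j\le N\\ j\ne i}}\frac{\sin\left(\frac{\beta_j}{y_j}\sqrt{Y_{i,n}-b_j^2}\right)}{\sqrt{Y_{i,n}-b_j^2}\cos\left(\frac{\pi}{2y_j}\sqrt{Y_{i,n}-b_j^2}\right)}$$ $$=\frac{\pi}{4}\prod_{i=1}^{M}\frac{\sin\left(\frac{\theta_i}{x_i}\sqrt{t^2-a_i^2}\right)}{\sqrt{t^2-a_i^2}\cos\left(\frac{\pi}{2x_i}\sqrt{t^2-a_i^2}\right)}\prod_{i=1}^{N}\frac{\sinh\left(\frac{\beta_i}{y_i}\sqrt{b_i^2-\frac{1}{t^2}}\right)}{\sqrt{b_i^2-\frac{1}{t^2}}\cosh\left(\frac{\pi}{2y_i}\sqrt{b_i^2-\frac{1}{t^2}}\right)}.$$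
   Context: Each factor has the form $\frac{\sin(\theta z/x)}{z\cos(\pi z/(2x))}$ or $\frac{\sinh(\theta z/x)}{z\cosh(\pi z/(2x))}$. These are even in $z$, so the choice of square root $z$ is irrelevant, and they have a removable singularity at $z=0$, where they are understood as the limit $\theta/x$. Empty products equal $1$. *)

(* Defs.v *)
From HB Require Import structures.
From mathcomp Require Import all_boot all_order all_algebra.
From mathcomp Require Import complex.
From mathcomp Require Import all_classical all_reals all_analysis.

Set Implicit Arguments.
Unset Strict Implicit.
Unset Printing Implicit Defensive.

Import Order.TTheory GRing.Theory Num.Theory.
Import numFieldNormedType.Exports.

Local Open Scope ring_scope.
Local Open Scope complex_scope.

Section ComplexFunctions.
Variable R : realType.
Implicit Types (theta : R) (x z : R[i]).

Definition cexp z : R[i] :=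
  (expR (complex.Re z))%:C * (cos (complex.Im z) +i* sin (complex.Im z)).

Definition csin z : R[i] := (cexp ('i%C * z) - cexp (- ('i%C * z))) / (2 * 'i%C).
Definition ccos z : R[i] := (cexp ('i%C * z) + cexp (- ('i%C * z))) / 2.
Definition csinh z : R[i] := (cexp z - cexp (- z)) / 2.
Definition ccosh z : R[i] := (cexp z + cexp (- z)) / 2.

(* The singularity at z = 0 of the next two quotients is removable, with limit
   theta / x.  Both are even in z, so their value at z = sqrtC w does not depend
   on which square root of w is taken. *)
Definition sin_factor theta x z : R[i] :=
  if z == 0 then theta%:C / x
  else csin (theta%:C / x * z) / (z * ccos (pi%:C / (2 * x) * z)).

Definition sinh_factor theta x z : R[i] :=
  if z == 0 then theta%:C / x
  else csinh (theta%:C / x * z) / (z * ccosh (pi%:C / (2 * x) * z)).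

End ComplexFunctions.

(* Main.v *)
(* With F_j(w) = sin_factor (theta j) (x j) (sqrt (w - a_j^2)), whose poles are the
   X_{j,n}, and G_j(s) the analogous function for (beta, y, b), the sinh factors are
   G_j(1/w), and the one-factor partial fraction expansion
     F_j(w) = (4/pi) x_j sum_n (-1)^n sin((2n+1) theta_j) / (X_{j,n} - w)
   expresses each F_j and G_j as a limit of finite sums.  For the truncated sums the
   theorem is an algebraic identity, obtained from
     1/((p-w)(q-w)) = 1/((p-w)(q-p)) + 1/((q-w)(p-q))   and
     1/((p-w)(q-1/w)) = 1/((p-w)(q-1/p)) + 1/(q(qw-1)(p-1/q)),
   and Tannery's theorem (dominated convergence for series) lets the truncation go to
   infinity: the condition on Im(x_i/x_j) makes the sums of 1/|X_{j,k} - X_{i,n}| over k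
   bounded uniformly in n.
   The one-factor expansion is again the limit of a finite identity: with
   phi_k = (2k+1)pi/(2m), the sum over k < m of (-1)^k sin(l phi_k)/(cos u - cos phi_k)
   satisfies h(l+1) + h(l-1) = 2 cos(u) h(l), hence equals
   m sin(l u)/(sin(u) cos(m u)); let m tend to infinity with u = pi z/(2m) and
   l ~ 2 m theta/pi. *)
Require Import Defs.
From HB Require Import structures.
From mathcomp Require Import all_boot all_order all_algebra.
From mathcomp Require Import complex ring lra zify.
From mathcomp Require Import all_classical all_reals all_analysis.
Import Order.TTheory GRing.Theory Num.Theory.
Import numFieldNormedType.Exports.
Import ComplexField.Normc.
Local Open Scope ring_scope.
Local Open Scope complex_scope.
Local Open Scope classical_set_scope.

Set Implicit Arguments.
Unset Strict Implicit.

(** * Convergence of complex sequences *)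

Lemma normr_normc (R : rcfType) (z : R[i]) : `|z| = (normc z)%:C.
Proof. by rewrite normc_def; case: z. Qed.

Lemma normc_ge0 (R : rcfType) (z : R[i]) : 0 <= normc z.
Proof. by rewrite -ler0c -normr_normc. Qed.

Lemma normc_real (R : rcfType) (r : R) : normc r%:C = `|r|.
Proof. by rewrite /= expr0n addr0 sqrtr_sqr. Qed.

Lemma normc_eq0 (R : rcfType) (z : R[i]) : (normc z == 0) = (z == 0).
Proof.
apply/eqP/eqP => [/eq0_normc //|->]; exact: normc0.
Qed.

Lemma normc_gt0 (R : rcfType) (z : R[i]) : (0 < normc z) = (z != 0).
Proof. by rewrite lt_def normc_ge0 andbT normc_eq0. Qed.

Lemma normc_distC (R : rcfType) (z w : R[i]) : normc (z - w) = normc (w - z).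
Proof. by rewrite -normcN opprB. Qed.

Lemma normc_le_dist (R : rcfType) (z w : R[i]) : normc z <= normc w + normc (w - z).
Proof. by rewrite normc_distC; have := le_normcD w (z - w); rewrite addrC subrK. Qed.

Lemma normc_subr_ge (R : rcfType) (z w : R[i]) : normc z - normc w <= normc (z - w).
Proof. by have := le_normcD (z - w) w; rewrite subrK lerBlDr. Qed.

Lemma normc_ge_absRe (R : rcfType) (z : R[i]) : `|complex.Re z| <= normc z.
Proof. by have := normc_ge_Re z; rewrite normr_normc lecR. Qed.

Lemma normc_ge_absIm (R : rcfType) (z : R[i]) : `|complex.Im z| <= normc z.
Proof.
case: z => x y /=; rewrite -sqrtr_sqr ler_wsqrtr // lerDr; exact: sqr_ge0.
Qed.

Lemma normc_le_ReIm (R : rcfType) (z : R[i]) :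
  normc z <= `|complex.Re z| + `|complex.Im z|.
Proof.
have := le_normcD ((complex.Re z)%:C) ('i%C * (complex.Im z)%:C).
rewrite -complexE normcM !normc_real.
by rewrite /= expr0n add0r expr1n sqrtr1 mul1r.
Qed.

Lemma ReB (R : rcfType) (z w : R[i]) : complex.Re (z - w) = complex.Re z - complex.Re w.
Proof. by case: z; case: w. Qed.

Lemma ImB (R : rcfType) (z w : R[i]) : complex.Im (z - w) = complex.Im z - complex.Im w.
Proof. by case: z; case: w. Qed.

Lemma normc_sum (R : rcfType) (I : Type) (r : seq I) (P : pred I) (F : I -> R[i]) :
  normc (\sum_(i <- r | P i) F i) <= \sum_(i <- r | P i) normc (F i).
Proof.
elim/big_ind2: _ => [|x a y b xa yb|//]; first by rewrite normc0.
exact: le_trans (le_normcD _ _) (lerD xa yb).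
Qed.

Lemma normc_prod (R : rcfType) (I : Type) (r : seq I) (P : pred I) (F : I -> R[i]) :
  normc (\prod_(i <- r | P i) F i) = \prod_(i <- r | P i) normc (F i).
Proof. by apply: (big_morph (@normc R) (@normcM R) (@normc1 R)). Qed.

Lemma normcX (R : rcfType) (z : R[i]) n : normc (z ^+ n) = normc z ^+ n.
Proof. by elim: n => [|n IH]; rewrite ?expr0 ?normc1// !exprS normcM IH. Qed.

(** The norm of [R[i]] takes values in [R[i]] itself; passing to [normc] makes the order and squeeze
    arguments of [R] available. *)
Lemma cvg_normcP (R : realType) (T : Type) (F : set_system T) {FF : Filter F}
    (f : T -> R[i]^o) (l : R[i]^o) :
  f x @[x --> F] --> l <-> (normc (f x - l) : R) @[x --> F] --> (0 : R).
Proof.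
split => [/cvgrPdist_lt h|/cvgrPdist_lt h].
  apply/cvgrPdist_lt => e e0.
  have e0' : 0 < (e%:C : R[i]) by rewrite ltcR.
  have := h _ e0'; apply: filterS => x.
  rewrite [`|l - _|]normr_normc ltcR => hx.
  by rewrite sub0r normrN ger0_norm ?normc_ge0// normc_distC.
apply/cvgrPdist_lt => e e0.
(* A positive element of [R[i]] is real, so this tolerance comes from [R]. *)
have er : e = (complex.Re e)%:C by rewrite RRe_real // gtr0_real.
set r := complex.Re e in er.
rewrite er ltcR in e0; have := h _ e0; apply: filterS => x.
rewrite sub0r normrN ger0_norm ?normc_ge0// normc_distC er => hx.
by rewrite [`|l - _|]normr_normc ltcR.
Qed.

Lemma cvg_ReIm (R : realType) (T : Type) (F : set_system T) {FF : Filter F}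
    (f : T -> R[i]^o) (l : R[i]^o) :
  complex.Re (f x) @[x --> F] --> complex.Re l ->
  complex.Im (f x) @[x --> F] --> complex.Im l -> f x @[x --> F] --> l.
Proof.
move=> hr hi; apply/cvg_normcP.
have hr' : `|complex.Re (f x) - complex.Re l| @[x --> F] --> (0 : R).
  by have := cvg_norm (cvgB hr (cvg_cst (complex.Re l))); rewrite subrr normr0; apply.
have hi' : `|complex.Im (f x) - complex.Im l| @[x --> F] --> (0 : R).
  by have := cvg_norm (cvgB hi (cvg_cst (complex.Im l))); rewrite subrr normr0; apply.
have := cvgD hr' hi'; rewrite addr0 => /(_ FF) h0.
apply: (squeeze_cvgr _ (cvg_cst 0) h0).
apply: nearW => x; rewrite normc_ge0 /=.
have := normc_le_ReIm (f x - l).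
by rewrite ReB ImB.
Qed.

Lemma cvg_realC (R : realType) (T : Type) (F : set_system T) {FF : Filter F}
    (f : T -> R) (l : R) :
  f x @[x --> F] --> l -> ((f x)%:C : R[i]^o) @[x --> F] --> (l%:C : R[i]^o).
Proof. by move=> h; apply: cvg_ReIm => //=; exact: cvg_cst. Qed.

(** Both series are cut to zero below [K], which does not affect convergence, so that the comparison
    test holds at every index. *)
Lemma dominated_series_cvg (R : realType) (g l : R^nat) K :
  cvgn (series g) -> (forall n, (K <= n)%N -> `|l n| <= g n) -> cvgn (series l).
Proof.
move=> cg h.
rewrite -(is_cvg_series_restrict K).
pose l' n := if (K <= n)%N then l n else 0.
pose g' n := if (K <= n)%N then g n else 0.
have cg' : cvgn (series g').
  rewrite -(is_cvg_series_restrict K).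
  have cg2 : cvgn [sequence \sum_(K <= k < n) g k]_n by rewrite (is_cvg_series_restrict K g).
  suff -> : [sequence \sum_(K <= k < n) g' k]_n = [sequence \sum_(K <= k < n) g k]_n by [].
  apply/funext => n /=; rewrite !big_nat; apply: eq_bigr => i /andP[Ki _].
  by rewrite /g' Ki.
suff -> : [sequence \sum_(K <= k < n) l k]_n = [sequence \sum_(K <= k < n) l' k]_n.
  rewrite is_cvg_series_restrict; apply: normed_cvg.
  apply: series_le_cvg cg' => n /=; first exact: normr_ge0.
    by rewrite /g'; case: ifP => // /h; apply: le_trans.
  by rewrite /l' /g'; case: ifP => [/h //|]; rewrite normr0.
apply/funext => n /=; rewrite !big_nat; apply: eq_bigr => i /andP[Ki _].
by rewrite /l' Ki.
Qed.

Lemma cvg_seriesC (R : realType) (g : R^nat) (l : nat -> R[i]^o) K :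
  cvgn (series g) -> (forall n, (K <= n)%N -> normc (l n) <= g n) ->
  cvgn (series l).
Proof.
move=> cg h.
have cr : cvgn (series (fun n => complex.Re (l n))).
  apply: dominated_series_cvg cg _ => n /h; apply: le_trans; exact: normc_ge_absRe.
have ci : cvgn (series (fun n => complex.Im (l n))).
  apply: dominated_series_cvg cg _ => n /h; apply: le_trans; exact: normc_ge_absIm.
apply/cvg_ex; exists (limn (series (fun n => complex.Re (l n))) +i*
  limn (series (fun n => complex.Im (l n)))).
have E : forall n, complex.Re (series l n) = series (fun n => complex.Re (l n)) n /\
    complex.Im (series l n) = series (fun n => complex.Im (l n)) n.
  elim=> [|n [IH1 IH2]]; first by rewrite /series /= !big_geq.
  rewrite /series /= !big_nat_recr //=; rewrite /series /= in IH1 IH2.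
  rewrite -IH1 -IH2; by case: (bigop _ _ _) => ? ?; case: (l n).
apply: cvg_ReIm => /=.
  by under eq_fun do rewrite (E _).1.
by under eq_fun do rewrite (E _).2.
Qed.

Lemma cvg_sum_ord (R : realType) (T : Type) (F : set_system T) {FF : Filter F}
    (K : nat) (f : T -> nat -> R[i]^o) (l : nat -> R[i]^o) :
  (forall n, f x n @[x --> F] --> l n) ->
  \sum_(n < K) f x n @[x --> F] --> \sum_(n < K) l n.
Proof. by move=> h; apply: cvg_big => [|i _]; [exact: add_continuous|exact: h]. Qed.

(** The tails of both sums are controlled by a tail of [g], uniformly in [N], while the head of
    fixed length converges term by term. *)
Lemma tannery (R : realType) (g : R^nat) (f : nat -> nat -> R[i]^o)
    (l : nat -> R[i]^o) (K : nat) :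
  cvgn (series g) ->
  (forall N n, (K <= n)%N -> normc (f N n) <= g n) ->
  (forall n, f N n @[N --> \oo] --> l n) ->
  cvgn (series l) /\ \sum_(n < N) f N n @[N --> \oo] --> limn (series l).
Proof.
move=> cg fg fl.
have lg n : (K <= n)%N -> normc (l n) <= g n.
  move=> Kn.
  have h : normc (f N n - l n) @[N --> \oo] --> (0 : R) by apply/cvg_normcP/fl.
  rewrite -[g n]addr0.
  apply: (ler_cvg_to (cvg_cst (normc (l n))) (cvgD (cvg_cst (g n)) h)).
  apply: nearW => N; apply: le_trans (normc_le_dist _ (f N n)) _.
  by rewrite lerD2r; exact: fg.
have cl : cvgn (series l) by apply: cvg_seriesC cg lg.
split=> //.
suff h : \sum_(n < N) f N n - series l N @[N --> \oo] --> (0 : R[i]^o).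
  under eq_fun => N do rewrite -(subrK (series l N) (\sum_(n < N) f N n)).
  by have := cvgD h cl; rewrite add0r; apply.
apply/cvg_normcP; apply/cvgrPdist_lt => e e0.
(* Two partial sums within [e / 8] of the limit bound the tail of [g] by [e / 4], hence by [e / 3];
   it counts twice, for [f] and for [l], and the head adds [e / 8], in all less than [e]. *)
have e3 : 0 < e / 8 by rewrite divr_gt0.
have /cvgrPdist_lt /(_ _ e3) [K0 _ hK0] := cg.
pose K1 := maxn K K0.
have KK1 : (K <= K1)%N by exact: leq_maxl.
have K01 : (K0 <= K1)%N by exact: leq_maxr.
have h1 : normc (\sum_(n < K1) f N n - \sum_(n < K1) l n) @[N --> \oo] --> (0 : R).
  by apply/cvg_normcP; exact: cvg_sum_ord.
have /cvgrPdist_lt /(_ _ e3) h2 := h1.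
near=> N.
have KN : (K1 <= N)%N by near: N; exact: nbhs_infty_ge.
rewrite sub0r normrN ger0_norm ?normc_ge0// subr0.
have hh : normc (\sum_(n < K1) f N n - \sum_(n < K1) l n) < e / 8.
  have : `|0 - normc (\sum_(n < K1) f N n - \sum_(n < K1) l n)| < e / 8 by near: N.
  by rewrite sub0r normrN ger0_norm ?normc_ge0.
have gg : \sum_(K1 <= n < N) g n < e / 3.
  have -> : \sum_(K1 <= n < N) g n = series g N - series g K1.
    by rewrite /series /= (@big_cat_nat _ _ _ K1 0 N) //= [RHS]addrC addKr.
  have := hK0 N (leq_trans K01 KN); have := hK0 K1 K01.
  rewrite /= !ltr_distl => /andP[a1 a2] /andP[a3 a4].
  lra.
rewrite /series /= -(big_mkord xpredT (f N)).
rewrite (@big_cat_nat _ _ _ K1 0 N _ (f N)) //= (@big_cat_nat _ _ _ K1 0 N _ l) //=.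
rewrite !(big_mkord xpredT) opprD addrACA.
apply: le_lt_trans (le_normcD _ _) _.
rewrite -[X in _ + normc X]sumrB.
have h3 : normc (\sum_(K1 <= i < N) (f N i - l i)) <= \sum_(K1 <= i < N) (g i + g i).
  apply: le_trans (normc_sum _ _ _) _; rewrite !big_nat; apply: ler_sum => i /andP[Ki _].
  apply: le_trans (le_normcD _ _) _; rewrite normcN lerD //.
  - by apply: fg; exact: leq_trans Ki.
  - by apply: lg; exact: leq_trans Ki.
rewrite [X in _ <= X]big_split /= in h3.
lra.
Unshelve. all: by end_near. Qed.

(** * Finite partial fractions *)

Definition cauchy_sum (K : fieldType) (d p : nat -> K) (L : nat) (w : K) : K :=
  \sum_(n < L) d n / (p n - w).

(** Induction on [s]: each product of two simple fractions splits by the identity for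
    1/((p-w)(q-w)). Only poles of different families meet in such a product, hence the form of the
    distinctness condition. *)
Lemma prod_cauchy_sum_seq (K : fieldType) (I : eqType) (d p : I -> nat -> K)
    (L : nat) (s : seq I) (w : K) :
  s != [::] -> uniq s ->
  (forall i n, i \in s -> p i n != w) ->
  (forall i j n k, i != j -> p i n != p j k) ->
  \prod_(i <- s) cauchy_sum (d i) (p i) L w =
  \sum_(i <- s) \sum_(n < L) d i n / (p i n - w) *
    \prod_(j <- s | j != i) cauchy_sum (d j) (p j) L (p i n).
Proof.
elim: s w => // a s IH w _ /= /andP[aNs us] pw pp.
have [s0|sn0] := eqVneq s [::].
  rewrite s0 !big_cons !big_nil mulr1 addr0 /cauchy_sum.
  by apply: eq_bigr => n _; rewrite big_cons eqxx big_nil /= mulr1.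
(* The induction hypothesis is read at the pole [p a n] in place of [w], which is why [w] is
   generalized. *)
have aE n : \prod_(j <- a :: s | j != a) cauchy_sum (d j) (p j) L (p a n) =
    \sum_(i <- s) \sum_(m < L) d i m / (p i m - p a n) *
    \prod_(j <- s | j != i) cauchy_sum (d j) (p j) L (p i m).
  rewrite big_cons eqxx /= -IH //.
    rewrite big_seq_cond [RHS]big_seq; apply: eq_bigl => j.
    by case: (boolP (j \in s)) => //= js; apply: contraNN aNs => /eqP <-.
  by move=> i m is_; apply: pp; apply: contraNneq aNs => <-.
rewrite !big_cons IH //; last by move=> i n is_; apply: pw; rewrite inE is_ orbT.
under [X in _ = X + _]eq_bigr => n _ do rewrite aE mulr_sumr.
rewrite [X in _ = X + _]exchange_big /= -big_split /= mulr_sumr.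
rewrite !big_seq; apply: eq_bigr => i is_.
have ai : a != i by apply: contraNneq aNs => ->.
under [X in _ = _ + X]eq_bigr => n _ do rewrite big_cons ai /=.
under [X in _ = X + _]eq_bigr => n _ do rewrite mulr_sumr.
rewrite [X in _ = X + _]exchange_big /= -big_split /= mulr_sumr; apply: eq_bigr => n _.
rewrite {1 3}/cauchy_sum !(mulr_sumr, mulr_suml) -big_split /=; apply: eq_bigr => m _.
have h1 : p a m - w != 0 by rewrite subr_eq0 pw // inE eqxx.
have h2 : p i n - w != 0 by rewrite subr_eq0 pw // inE is_ orbT.
have h3 : p i n - p a m != 0 by rewrite subr_eq0 pp // eq_sym.
have h4 : p a m - p i n != 0 by rewrite subr_eq0 pp.
by field; rewrite h1 h2 h3 h4.
Qed.

Lemma prod_cauchy_sum (K : fieldType) (M : nat) (d p : 'I_M -> nat -> K)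
    (L : nat) (w : K) :
  (0 < M)%N -> (forall i n, p i n != w) ->
  (forall i j n k, i != j -> p i n != p j k) ->
  \prod_(i < M) cauchy_sum (d i) (p i) L w =
  \sum_(i < M) \sum_(n < L) d i n / (p i n - w) *
    \prod_(j < M | j != i) cauchy_sum (d j) (p j) L (p i n).
Proof.
move=> M0 pw pp; apply: prod_cauchy_sum_seq => //; last exact: index_enum_uniq.
by rewrite -size_eq0 -lt0n /index_enum -enumT size_enum_ord.
Qed.

(** Each product is decomposed by [prod_cauchy_sum]; a fraction in [w] times a fraction in [w^-1]
    then separates by the identity for 1/((p-w)(q-1/w)). *)
Lemma mul_prod_cauchy_sum (K : fieldType) (M N : nat)
    (d p : 'I_M -> nat -> K) (e q : 'I_N -> nat -> K) (L : nat) (w : K) :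
  (0 < M)%N -> (0 < N)%N -> w != 0 ->
  (forall i n, p i n != 0) -> (forall j m, q j m != 0) ->
  (forall i n, p i n != w) -> (forall j m, q j m != w^-1) ->
  (forall i j n m, p i n * q j m != 1) ->
  (forall i j n k, i != j -> p i n != p j k) ->
  (forall i j n k, i != j -> q i n != q j k) ->
  (\prod_(i < M) cauchy_sum (d i) (p i) L w) *
  (\prod_(j < N) cauchy_sum (e j) (q j) L w^-1) =
  \sum_(i < M) \sum_(n < L) d i n / (p i n - w) *
    (\prod_(j < N) cauchy_sum (e j) (q j) L (p i n)^-1) *
    (\prod_(j < M | j != i) cauchy_sum (d j) (p j) L (p i n)) +
  \sum_(i < N) \sum_(n < L) e i n / (q i n * (q i n * w - 1)) *
    (\prod_(j < M) cauchy_sum (d j) (p j) L (q i n)^-1) *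
    (\prod_(j < N | j != i) cauchy_sum (e j) (q j) L (q i n)).
Proof.
move=> M0 N0 w0 p0 q0 pw qw pq pp qq.
rewrite !prod_cauchy_sum //.
pose Pi i n := \prod_(j < M | j != i) cauchy_sum (d j) (p j) L (p i n).
pose Qi i n := \prod_(j < N | j != i) cauchy_sum (e j) (q j) L (q i n).
(* The full products at the inverse poles are expanded too, so both sides become sums over [i], [j],
   [n], [m] that can be compared term by term. *)
under [X in _ = X + _]eq_bigr => i _ do under eq_bigr => n _ do
  (rewrite prod_cauchy_sum //; last (by move=> j m; apply: contra_neq (pq i j n m) => ->; rewrite mulfV)).
under [X in _ = _ + X]eq_bigr => i _ do under eq_bigr => n _ do
  (rewrite prod_cauchy_sum //; last (by move=> j m; apply: contra_neq (pq j i m n) => ->; rewrite mulVf)).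
transitivity (\sum_(i < M) \sum_(j < N) \sum_(n < L) \sum_(m < L)
  (d i n / (p i n - w) * Pi i n) * (e j m / (q j m - w^-1) * Qi j m)).
  rewrite mulr_suml; apply: eq_bigr => i _; rewrite mulr_sumr; apply: eq_bigr => j _.
  by rewrite mulr_suml; apply: eq_bigr => n _; rewrite mulr_sumr.
transitivity (
  \sum_(i < M) \sum_(j < N) \sum_(n < L) \sum_(m < L)
  d i n / (p i n - w) * (e j m / (q j m - (p i n)^-1) * Qi j m) * Pi i n +
  \sum_(i < M) \sum_(j < N) \sum_(n < L) \sum_(m < L)
  e j m / (q j m * (q j m * w - 1)) * (d i n / (p i n - (q j m)^-1) * Pi i n) * Qi j m).
  rewrite -big_split; apply: eq_bigr => i _; rewrite -big_split; apply: eq_bigr => j _.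
  rewrite -big_split; apply: eq_bigr => n _; rewrite -big_split; apply: eq_bigr => m _ /=.
  have h1 : p i n - w != 0 by rewrite subr_eq0.
  have h2 : q j m * w - 1 != 0.
    by rewrite subr_eq0; apply: contra_neq (qw j m) => /(canRL (mulfK w0)) ->; rewrite mul1r.
  have h3 : p i n * q j m - 1 != 0 by rewrite subr_eq0.
  have -> : q j m - w^-1 = (q j m * w - 1) / w by field.
  have -> : q j m - (p i n)^-1 = (p i n * q j m - 1) / p i n by field; rewrite p0.
  have -> : p i n - (q j m)^-1 = (p i n * q j m - 1) / q j m by field; rewrite q0.
  by field; rewrite ?h1 ?h2 ?h3 ?w0 ?p0 ?q0.
congr (_ + _).
  apply: eq_bigr => i _; rewrite exchange_big /=; apply: eq_bigr => n _.
  rewrite mulr_sumr mulr_suml; apply: eq_bigr => j _.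
  by rewrite mulr_sumr mulr_suml.
rewrite exchange_big; apply: eq_bigr => j _ /=.
under eq_bigr => i _ do rewrite exchange_big.
rewrite exchange_big /=; apply: eq_bigr => m _.
rewrite mulr_sumr mulr_suml; apply: eq_bigr => i _.
by rewrite mulr_sumr mulr_suml.
Qed.

(** * Distances between poles *)

(** The pairs with [k + n < K] lie in a finite square; the minimum of [c] and of the values on that
    square is positive. *)
Lemma uniform_lower_bound2 (R : realFieldType) (f : nat -> nat -> R) K c :
  0 < c -> (forall k n, 0 < f k n) ->
  (forall k n, (K <= k + n)%N -> c <= f k n) ->
  exists2 c', 0 < c' & forall k n, c' <= f k n.
Proof.
move=> c0 f0 fc.
exists (\big[Num.min/c]_(i < K) \big[Num.min/c]_(j < K) f i j).
  elim/big_ind: _ => // [u v u0 v0|i _]; first by rewrite lt_min u0 v0.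
  by elim/big_ind: _ => // u v u0 v0; rewrite lt_min u0 v0.
move=> k n; have [kn|] := leqP K (k + n).
  by apply: le_trans (fc _ _ kn); exact: bigmin_le_id.
move=> kn.
have kK : (k < K)%N by lia.
have nK : (n < K)%N by lia.
rewrite (bigD1 (Ordinal kK)) //= ge_min (bigD1 (Ordinal nK)) //= ge_min lexx //.
Qed.

Lemma uniform_lower_bound (R : realFieldType) (f : nat -> R) K c :
  0 < c -> (forall n, 0 < f n) -> (forall n, (K <= n)%N -> c <= f n) ->
  exists2 c', 0 < c' & forall n, c' <= f n.
Proof.
move=> c0 f0 fc.
have [//||c' c'0 h] := @uniform_lower_bound2 R (fun k n => f (k + n)%N) K c c0.
- by move=> k n; exact: fc.
- by exists c' => // n; rewrite -[n]add0n.
Qed.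

Definition pole (R : rcfType) (x a : R[i]) (n : nat) : R[i] :=
  (2 * n + 1)%:R ^+ 2 * x ^+ 2 + a ^+ 2.

(* |k - n|: one of the two truncated differences is 0. *)
Definition gap (k n : nat) : nat := ((k - n) + (n - k))%N.

Lemma normc_nat (R : rcfType) n : normc (n%:R : R[i]) = n%:R.
Proof. by rewrite -[n%:R](rmorph_nat (real_complex R)) normc_real ger0_norm. Qed.

Lemma nat_bound (R : realType) (x : R) : exists K, forall n, (K <= n)%N -> x <= n%:R.
Proof.
exists (Num.bound `|x|) => n Kn; apply: le_trans (ler_norm _) _.
apply/ltW/(lt_le_trans (archi_boundP (normr_ge0 x))).
by rewrite ler_nat.
Qed.

(** For large [n] the leading term (2n+1)^2 x^2 outweighs w - a^2; the finitely many other [n] only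
    need a nonzero difference. *)
Lemma pole_dist (R : realType) (x a w : R[i]) :
  x != 0 -> (forall n, pole x a n != w) ->
  exists2 c : R, 0 < c & forall n, c * n.+1%:R ^+ 2 <= normc (pole x a n - w).
Proof.
move=> x0 pw.
have X0 : 0 < normc x ^+ 2 by rewrite exprn_gt0 // normc_gt0.
have [K hK] := nat_bound (normc (w - a ^+ 2) / normc x ^+ 2 * 2).
have [||n Kn|c c0 h] := @uniform_lower_bound R
   (fun n => normc (pole x a n - w) / n.+1%:R ^+ 2) K (normc x ^+ 2 / 2).
- by rewrite divr_gt0.
- by move=> n; rewrite divr_gt0 // normc_gt0 subr_eq0.
- rewrite ler_pdivlMr ?exprn_gt0 //.
  have -> : pole x a n - w = (2 * n + 1)%:R ^+ 2 * x ^+ 2 - (w - a ^+ 2).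
    by rewrite /pole; ring.
  apply: le_trans (normc_subr_ge _ _); rewrite normcM !normcX normc_nat.
  have := hK n Kn; rewrite mulrAC ler_pdivrMr // => h.
  set X := normc x ^+ 2 in h X0 *; set W := normc _ in h *.
  rewrite natrD natrM -[n.+1%:R]natr1; have : 0 <= n%:R :> R by [].
  move: (n%:R : R) h => y h y0.
  have h1 : 0 <= y * X by rewrite mulr_ge0 // ltW.
  have h2 : 0 <= y * (y * X) by rewrite mulr_ge0.
  lra.
- by exists c => // n; rewrite -ler_pdivlMr ?exprn_gt0.
Qed.

(** This serves the factors evaluated at the inverse of a pole of the other family. As |p n|^-1 is
    at most 1/(c (n+1)^2), it stays below half of c' (k+1)^2 once [k + n] is large, and finitely
    many pairs remain. *)
Lemma inv_dist (R : realType) (p q : nat -> R[i]) (c c' : R) :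
  0 < c -> 0 < c' ->
  (forall n, c * n.+1%:R ^+ 2 <= normc (p n)) ->
  (forall n, c' * n.+1%:R ^+ 2 <= normc (q n)) ->
  (forall n k, p n * q k != 1) ->
  exists2 c'' : R, 0 < c'' &
    forall k n, c'' * k.+1%:R ^+ 2 <= normc (q k - (p n)^-1).
Proof.
move=> c0 c'0 hp hq pq.
have [K hK] := nat_bound (2 / (c * c')).
have [||k n Kn|c'' c''0 h] := @uniform_lower_bound2 R
   (fun k n => normc (q k - (p n)^-1) / k.+1%:R ^+ 2) K (c' / 2).
- by rewrite divr_gt0.
- move=> k n; rewrite divr_gt0 // normc_gt0 subr_eq0.
  apply: contra_neq (pq n k) => ->; rewrite mulfV // -normc_gt0.
  by apply: lt_le_trans (hp n); rewrite mulr_gt0 // exprn_gt0.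
- rewrite ler_pdivlMr ?exprn_gt0 //.
  apply: le_trans (normc_subr_ge _ _); rewrite normcV.
  have h1 : (normc (p n))^-1 <= (c * n.+1%:R ^+ 2)^-1.
    rewrite lef_pV2 ?hp// posrE ?mulr_gt0 ?exprn_gt0//.
    by apply: lt_le_trans (hp n); rewrite mulr_gt0 ?exprn_gt0.
  have h2 : (c * n.+1%:R ^+ 2)^-1 <= c' / 2 * k.+1%:R ^+ 2.
    rewrite -[leLHS]mul1r ler_pdivrMr ?mulr_gt0 ?exprn_gt0//.
    have := hK _ Kn; rewrite ler_pdivrMr ?mulr_gt0// natrD -[n.+1%:R]natr1 -[k.+1%:R]natr1.
    have : 0 <= n%:R :> R by []. have : 0 <= k%:R :> R by [].
    move: (n%:R : R) (k%:R : R) => u v v0 u0 h.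
    (* This turns [2 / (c * c') <= k + n] into the comparison of 1/(c (n+1)^2) with c' (k+1)^2 /
       2. *)
    have h3 : (v + u) <= ((u + 1) * (v + 1)) ^+ 2.
      have uv0 : 0 <= u * v by rewrite mulr_ge0.
      have : 1 + (u + v) <= (u + 1) * (v + 1) by lra.
      by move: (_ * (v + 1)) => s ?; rewrite expr2; nra.
    have h4 : 0 < c * c' by rewrite mulr_gt0.
    have := ler_wpM2r (ltW h4) h3 => h5.
    lra.
  move: (le_trans h1 h2) (hq k); move: (normc (q k)) (normc (p n))^-1 (k.+1%:R ^+ 2 : R) => A B D; lra.
- by exists c'' => // k n; rewrite -ler_pdivlMr ?exprn_gt0.
Qed.

(** As [r] is not real, 1 and [r] are independent over the reals. For z = k - n r, n is at most |z|
    / |Im r| and k at most |z| + n |r|; adding the two gives the constant. *)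
Lemma norm_ge_realD (R : rcfType) (r : R[i]) : complex.Im r != 0 ->
  exists2 m : R, 0 < m & forall k n : R, 0 <= k -> 0 <= n ->
    m * (k + n) <= normc (k%:C - n%:C * r) /\ m * (k + n) <= normc (k%:C + n%:C * r).
Proof.
move=> r0; set s := `|complex.Im r|.
have s0 : 0 < s by rewrite normr_gt0.
(* Both signs are handled at once: [r] and [- r] have the same modulus and the same absolute
   imaginary part. *)
suff h (r' : R[i]) : normc r' = normc r -> `|complex.Im r'| = s ->
    forall k n : R, 0 <= k -> 0 <= n ->
    (1 + (normc r + 1) / s)^-1 * (k + n) <= normc (k%:C - n%:C * r').
  exists (1 + (normc r + 1) / s)^-1.
    by rewrite invr_gt0 addr_gt0 // divr_gt0 // ltr_wpDl // normc_ge0.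
  move=> k n k0 n0; split; first exact: h.
  have -> : k%:C + n%:C * r = k%:C - n%:C * - r by rewrite mulrN opprK.
  apply: h => //; first exact: normcN.
  by rewrite /s -[RHS]normrN; case: (r).
move=> nr' ir' k n k0 n0.
set z := k%:C - _.
have P : 0 < 1 + (normc r + 1) / s.
  by rewrite addr_gt0 // divr_gt0 // ltr_wpDl // normc_ge0.
rewrite mulrC ler_pdivrMr //.
have h1 : n * s <= normc z.
  apply: le_trans (normc_ge_absIm z).
  rewrite /z ImB /= sub0r normrN -ir'.
  case: (r') => u v /=; rewrite mul0r addr0 normrM ger0_norm //.
have h2 : k <= normc z + n * normc r.
  have := le_normcD z (n%:C * r').
  by rewrite /z subrK normcM !normc_real !ger0_norm // nr'.
have h3 : n <= normc z / s by rewrite ler_pdivlMr.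
have h4 : n * normc r <= normc z / s * normc r by rewrite ler_wpM2r // normc_ge0.
rewrite mulrDr mulr1 mulrA mulrDr mulr1 mulrDl; lra.
Qed.

(** This is what makes the sums of inverse distances over [k] bounded uniformly in [n]. The leading
    terms stay apart because x/x' is not real or, when x = x', because they agree only at k = n. *)
Lemma pole_separation (R : realType) (x x' a a' : R[i]) :
  x != 0 -> x' != 0 -> complex.Im (x / x') != 0 \/ x = x' ->
  (forall n k, pole x a n != pole x' a' k) ->
  exists2 c : R, 0 < c & forall k n,
    c * (gap k n).+1%:R ^+ 2 <= normc (pole x' a' k - pole x a n).
Proof.
move=> x0 x'0 xx' pp.
set D := normc (a ^+ 2 - a' ^+ 2).
suff [K [c c0 h]] : exists K, exists2 c : R, 0 < c & forall k n, (K <= k + n)%N ->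
    c * (gap k n).+1%:R ^+ 2 <= normc (pole x' a' k - pole x a n).
  have [|k n Kn|c'' c''0 h''] := @uniform_lower_bound2 R
    (fun k n => normc (pole x' a' k - pole x a n) / (gap k n).+1%:R ^+ 2) K c c0.
  - by move=> k n; rewrite divr_gt0 ?exprn_gt0 // normc_gt0 subr_eq0 eq_sym.
  - by rewrite ler_pdivlMr ?exprn_gt0 //; exact: h.
  - by exists c'' => // k n; rewrite -ler_pdivlMr ?exprn_gt0.
have X0 : 0 < normc x' ^+ 2 by rewrite exprn_gt0 // normc_gt0.
have gapD k n : (gap k n <= k + n)%N by rewrite /gap; lia.
case: xx' => [im|xx].
  have [m m0 hm] := norm_ge_realD im.
  have c0 : 0 < normc x' ^+ 2 * m ^+ 2 by rewrite mulr_gt0 // exprn_gt0.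
  have [K hK] := nat_bound (D / (normc x' ^+ 2 * m ^+ 2)).
  exists K, (normc x' ^+ 2 * m ^+ 2) => // k n Kn.
  (* A difference of squares: [norm_ge_realD] bounds each linear factor below by a multiple of 2k+1
     + 2n+1. *)
  have -> : pole x' a' k - pole x a n = x' ^+ 2 *
    ((((2 * k + 1)%:R : R)%:C - ((2 * n + 1)%:R : R)%:C * (x / x')) *
     (((2 * k + 1)%:R : R)%:C + ((2 * n + 1)%:R : R)%:C * (x / x'))) - (a ^+ 2 - a' ^+ 2).
    by rewrite /pole !rmorph_nat; field.
  apply: le_trans (normc_subr_ge _ _); rewrite -/D normcM normcX normcM.
  have [h1 h2] := hm (2 * k + 1)%:R (2 * n + 1)%:R (ler0n _ _) (ler0n _ _).
  have h3 := ler_pM _ _ h1 h2; rewrite !mulr_ge0 ?(ltW m0) ?addr_ge0// in h3.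
  have {}h3 := ler_wpM2l (ltW X0) (h3 isT isT).
  move: h3; set A := normc (_ - _); set B := normc (_ + _) => h3.
  have := hK _ Kn; rewrite ler_pdivrMr // => h4.
  have h5 : ((gap k n).+1%:R : R) <= k%:R + n%:R + 1.
    by rewrite -natrD natr1 ler_nat ltnS.
  have h6 : ((gap k n).+1%:R : R) ^+ 2 <= (k%:R + n%:R + 1) ^+ 2 by rewrite lerXn2r // nnegrE.
  have := ler_wpM2l (ltW c0) h6 => h7.
  rewrite (natrD _ (2 * k)) (natrD _ (2 * n)) !natrM in h3; rewrite natrD in h4.
  have : 0 <= n%:R :> R by []. have : 0 <= k%:R :> R by [].
  move: (n%:R : R) (k%:R : R) h3 h4 h7 => u v h3 h4 h7 v0 u0.
  have h8 : 0 <= (u + v) ^+ 2 * (normc x' ^+ 2 * m ^+ 2) by rewrite mulr_ge0 // ?sqr_ge0 // ltW.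
  have D0 : 0 <= D by exact: normc_ge0.
  lra.
subst x'.
(* On the diagonal k = n only the constant a'^2 - a^2 is left, and it is nonzero because the poles
   differ. *)
have D0 : 0 < D.
  rewrite normc_gt0 subr_eq0; apply: contra_neq (pp 0 0)%N => aa.
  by rewrite /pole aa.
have [K hK] := nat_bound (D / normc x ^+ 2).
exists K, (Num.min (normc x ^+ 2) D); first by rewrite lt_min X0.
move=> k n Kn.
have [kn|kn] := eqVneq k n.
  have -> : pole x a' k - pole x a n = - (a ^+ 2 - a' ^+ 2) by rewrite /pole kn; ring.
  rewrite normcN -/D /gap kn subnn expr1n mulr1 ge_min lexx orbT //.
(* Off the diagonal the leading part is 4 x^2 (k-n)(k+n+1), and k+n+1 exceeds the gap. *)
have -> : pole x a' k - pole x a n = x ^+ 2 * (4 * ((k%:R - n%:R) * (k + n).+1%:R)) - (a ^+ 2 - a' ^+ 2).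
  by rewrite /pole; ring.
apply: le_trans (normc_subr_ge _ _); rewrite -/D normcM normcX normcM normcM !normc_nat.
have -> : normc (k%:R - n%:R : R[i]) = (gap k n)%:R.
  rewrite /gap; have [kn'|/ltnW kn'] := leqP k n.
    by rewrite normc_distC -natrB // normc_nat (eqP (_ : (k - n == 0)%N)) ?subn_eq0.
  by rewrite -natrB // normc_nat (eqP (_ : (n - k == 0)%N)) ?subn_eq0 // addn0.
have g1 : 1 <= (gap k n)%:R :> R by rewrite ler1n /gap; move/eqP in kn; lia.
have gD : (gap k n)%:R <= (k + n)%:R :> R by rewrite ler_nat.
have := hK _ Kn; rewrite ler_pdivrMr // => h4.
rewrite -[(gap k n).+1%:R]natr1 -[(k + n).+1%:R]natr1.
apply: (@le_trans _ _ (normc x ^+ 2 * ((gap k n)%:R + 1) ^+ 2)).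
  by rewrite ler_wpM2r ?sqr_ge0 // ge_min lexx.
move: ((gap k n)%:R : R) ((k + n)%:R : R) g1 gD h4 => u v u1 uv h4.
have h5 : (u + 1) ^+ 2 + v <= 4 * (u * (v + 1)) by nra.
have := ler_wpM2l (ltW X0) h5; rewrite mulrDr; lra.
Qed.

(** * Sums of inverse squares and bounds for truncated sums *)

Lemma sum_inv_sqr_le2 (R : realFieldType) N :
  \sum_(j < N) (j.+1%:R ^+ 2)^-1 <= 2 :> R.
Proof.
case: N => [|N]; first by rewrite big_ord0.
(* The sharper bound 2 - 1/(N+1) telescopes and therefore passes through the induction. *)
suff h : \sum_(j < N.+1) (j.+1%:R ^+ 2)^-1 <= 2 - N.+1%:R^-1 :> R.
  by apply: le_trans h _; rewrite gerBl invr_ge0.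
elim: N => [|N IH]; first by rewrite big_ord_recl big_ord0 /= expr1n invr1; lra.
rewrite big_ord_recr /= (le_trans (lerD IH (lexx _))) //.
rewrite -[N.+2%:R]natr1; have : 1 <= N.+1%:R :> R by rewrite ler1n.
move: (N.+1%:R : R) => u u1.
have u0 : u != 0 by lra.
have u10 : u + 1 != 0 by lra.
rewrite -subr_ge0.
have -> : 2 - (u + 1)^-1 - (2 - u^-1 + ((u + 1) ^+ 2)^-1) = (u * (u + 1) ^+ 2)^-1.
  by field; rewrite u0 u10.
rewrite invr_ge0 mulr_ge0 ?sqr_ge0 //; lra.
Qed.

(** The sum is extended to [n + N] terms and cut at k = n; on each side the gaps run through
    consecutive integers, so each half is at most a sum of inverse squares. *)
Lemma sum_gap_le (R : realFieldType) N n :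
  \sum_(k < N) ((gap k n).+1%:R ^+ 2)^-1 <= 4 :> R.
Proof.
pose h k : R := (k.+1%:R ^+ 2)^-1.
have h0 k : 0 <= h k by rewrite invr_ge0 sqr_ge0.
apply: (@le_trans _ _ (\sum_(k < n + N) h (gap k n))).
  rewrite -!(big_mkord xpredT (fun k => h (gap k n))).
  by rewrite (@big_cat_nat _ _ _ N 0 (n + N)) ?leq_addl //= lerDl sumr_ge0.
rewrite big_split_ord /= (_ : 4 = 2 + 2 :> R); last by ring.
apply: lerD.
  apply: le_trans (sum_inv_sqr_le2 _ n).
  rewrite (reindex_inj rev_ord_inj) /=; apply: ler_sum => k _.
  rewrite /h lef_pV2 ?posrE ?exprn_gt0// lerXn2r ?nnegrE // ler_nat ltnS /gap.
  by have := ltn_ord k; lia.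
apply: le_trans (sum_inv_sqr_le2 _ N); apply: ler_sum => k _.
by rewrite /h (_ : gap (n + k) n = k) // /gap; lia.
Qed.

Lemma is_cvg_series_inv_sqr (R : realType) (B : R) :
  cvgn (series (fun n => B * (n.+1%:R ^+ 2)^-1)).
Proof.
apply: is_cvg_seriesZ; apply: nondecreasing_is_cvgn.
  by apply/nondecreasing_series => n _ _; rewrite invr_ge0 sqr_ge0.
exists 2 => _ [N _ <-]; rewrite /series /= big_mkord; exact: sum_inv_sqr_le2.
Qed.

(** In the applications [h] is the square of [k.+1] or of [(gap k n).+1], for which a bound [H]
    independent of [L] is known. *)
Lemma normc_cauchy_sum_le (R : rcfType) (d p : nat -> R[i]) (w : R[i])
    (h : nat -> R) (D c H : R) (L : nat) :
  0 <= D -> 0 < c -> (forall k, 0 < h k) ->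
  (forall k, normc (d k) <= D) -> (forall k, c * h k <= normc (p k - w)) ->
  \sum_(k < L) (h k)^-1 <= H ->
  normc (cauchy_sum d p L w) <= D / c * H.
Proof.
move=> D0 c0 h0 hd hp hH.
apply: le_trans (normc_sum _ _ _) _.
apply: le_trans (ler_wpM2l _ hH); last by rewrite divr_ge0 // ltW.
rewrite mulr_sumr; apply: ler_sum => k _; rewrite normcM normcV -mulrA -invfM.
apply: ler_pM => //; rewrite ?normc_ge0 ?invr_ge0 ?normc_ge0 //.
by rewrite lef_pV2 ?posrE ?(lt_le_trans _ (hp k)) // mulr_gt0.
Qed.

(** * Complex trigonometric functions *)

Lemma cvg_cong (T : Type) (F : set_system T) (U : topologicalType)
    (f g : T -> U) (l l' : U) :
  f x @[x --> F] --> l -> (forall x, f x = g x) -> l = l' -> g x @[x --> F] --> l'.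
Proof. by move=> h /funext <- <-. Qed.

Section Trig.
Variable R : realType.
Implicit Types (z w : R[i]) (r : R).

Lemma cexpD z w : cexp (z + w) = cexp z * cexp w.
Proof.
case: z w => [a b] [c d]; rewrite /cexp /= expRD cosD sinD.
by apply/eqP; rewrite eq_complex /=; apply/andP; split; apply/eqP; ring.
Qed.

Lemma cexp0 : cexp (0 : R[i]) = 1.
Proof. by rewrite /cexp /= expR0 cos0 sin0 mul1r. Qed.

Lemma i_neq0 : 'i%C != 0 :> R[i].
Proof. by rewrite eq_complex /= oner_eq0 andbF. Qed.

Lemma csinD z w : csin (z + w) = csin z * ccos w + ccos z * csin w.
Proof. by rewrite /csin /ccos mulrDr opprD !cexpD; field; rewrite i_neq0. Qed.

Lemma ccosD z w : ccos (z + w) = ccos z * ccos w - csin z * csin w.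
Proof.
rewrite /csin /ccos mulrDr opprD !cexpD.
have h : 'i%C ^+ 2 = -1 :> R[i] by exact: sqr_i.
set A := cexp _; set B := cexp _; set C := cexp _; set D := cexp _.
have -> : (A - C) / (2 * 'i%C) * ((B - D) / (2 * 'i%C)) = (A - C) * (B - D) / (4 * 'i%C ^+ 2).
  by field; rewrite i_neq0.
by rewrite h; field.
Qed.

Lemma csinN z : csin (- z) = - csin z.
Proof. by rewrite /csin mulrN opprK -[RHS]mulNr opprB. Qed.

Lemma ccosN z : ccos (- z) = ccos z.
Proof. by rewrite /ccos mulrN opprK addrC. Qed.

Lemma csin0 : csin (0 : R[i]) = 0.
Proof. by rewrite /csin mulr0 oppr0 subrr mul0r. Qed.

Lemma ccos0 : ccos (0 : R[i]) = 1.
Proof. by rewrite /ccos mulr0 oppr0 cexp0; field. Qed.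

Lemma ccos2Dcsin2 z : ccos z ^+ 2 + csin z ^+ 2 = 1.
Proof.
by have := ccosD z (- z); rewrite subrr ccos0 ccosN csinN mulrN opprK -!expr2.
Qed.

Lemma ccos_half z : 1 - ccos z = 2 * csin (z / 2) ^+ 2.
Proof.
rewrite {1}(_ : z = z / 2 + z / 2) ?ccosD; last by field.
by rewrite -!expr2; have /(canRL (addrK _)) -> := ccos2Dcsin2 (z / 2); ring.
Qed.

Lemma csin_real r : csin r%:C = (sin r)%:C.
Proof.
rewrite /csin /cexp /= !(mul0r, mul1r, mulr0, subr0, addr0, add0r, oppr0, expR0).
apply: (canLR (mulfK _)); first by rewrite mulf_neq0 ?i_neq0 ?pnatr_eq0.
rewrite cosN sinN; apply/eqP; rewrite eq_complex /=; apply/andP; split; apply/eqP; ring.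
Qed.

Lemma ccos_real r : ccos r%:C = (cos r)%:C.
Proof.
rewrite /ccos /cexp /= !(mul0r, mul1r, mulr0, subr0, addr0, add0r, oppr0, expR0).
apply: (canLR (mulfK _)); first by rewrite pnatr_eq0.
rewrite cosN sinN; apply/eqP; rewrite eq_complex /=; apply/andP; split; apply/eqP; ring.
Qed.

Lemma csinh_csin z : csin ('i%C * z) = 'i%C * csinh z.
Proof.
rewrite /csin /csinh mulrA -expr2 sqr_i mulN1r opprK.
have h : 'i%C ^+ 2 = -1 :> R[i] by exact: sqr_i.
apply: (canLR (mulfK _)); first by rewrite mulf_neq0 ?i_neq0 ?pnatr_eq0.
set A := cexp _; set B := cexp _.
have -> : 'i%C * ((B - A) / 2) * (2 * 'i%C) = 'i%C ^+ 2 * (B - A) by field.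
by rewrite h; ring.
Qed.

Lemma ccosh_ccos z : ccos ('i%C * z) = ccosh z.
Proof. by rewrite /ccos /ccosh mulrA -expr2 sqr_i mulN1r opprK addrC. Qed.

(** The i in sin(iz) = i sinh z cancels against the one in the denominator, so the expansion of sine
    factors also covers the hyperbolic ones. *)
Lemma sinh_factorE (theta : R) x z : sinh_factor theta x z = sin_factor theta x ('i%C * z).
Proof.
rewrite /sinh_factor /sin_factor mulf_eq0 (negPf i_neq0) /=.
case: eqVneq => // z0; rewrite !(mulrCA _ 'i%C) csinh_csin ccosh_ccos.
by rewrite -['i%C * z * _]mulrA [('i%C * _)^-1]invfM mulrACA divff ?i_neq0 // mul1r.
Qed.

Lemma sin_factor_thetaN (theta : R) x z :
  sin_factor (- theta) x z = - sin_factor theta x z.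
Proof.
rewrite /sin_factor rmorphN !mulNr; case: eqVneq => // _.
by rewrite csinN mulNr.
Qed.

Lemma is_derive_seq (f : R -> R) (df : R) : is_derive (0 : R) (1 : R) f df ->
  m%:R * (f m%:R^-1 - f 0) @[m --> \oo] --> df.
Proof.
move=> [dv <-].
have h : m.+1%:R^-1 @[m --> \oo] --> (0 : R)^'.
  move=> A hA; have : \forall m \near \oo, (m.+1%:R^-1 != 0 :> R -> A m.+1%:R^-1) := @cvg_harmonic R _ hA.
  by apply: filterS => m; apply; rewrite invr_eq0.
rewrite -cvg_shiftS.
have := cvg_comp _ _ h dv.
set F := (_ \o _); have -> // : F = (fun n : nat => n.+1%:R * (f n.+1%:R^-1 - f 0)).
by apply/funext => n; rewrite /F /= invrK /shift /= addr0 /GRing.scale /= mulr1.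
Qed.

(** The limit is the derivative at 0 of exp(t w) in the real variable t, taken on real and imaginary
    parts so that only real differentiation enters. *)
Lemma cvg_nat_mul_cexp_sub1 w : (m%:R * (cexp (w / m%:R) - 1) : R[i]^o) @[m --> \oo] --> (w : R[i]^o).
Proof.
case: w => a b.
have E m : (a +i* b) / m%:R = (m%:R^-1 * a) +i* (m%:R^-1 * b) :> R[i].
  have -> : (m%:R : R[i]) = (m%:R : R)%:C by rewrite rmorph_nat.
  rewrite -fmorphV; apply/eqP; rewrite eq_complex /=; apply/andP; split; apply/eqP; ring.
have E2 m : m%:R * (cexp ((a +i* b) / m%:R) - 1) =
  (m%:R * (expR (m%:R^-1 * a) * cos (m%:R^-1 * b) - 1)) +i*
  (m%:R * (expR (m%:R^-1 * a) * sin (m%:R^-1 * b) - 0)).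
  rewrite E /cexp /= -[in LHS](rmorph_nat (real_complex R)).
  apply/eqP; rewrite eq_complex /=; apply/andP; split; apply/eqP; ring.
under eq_fun => m do rewrite E2.
apply: cvg_ReIm => /=.
  have d : is_derive (0 : R) (1 : R) (fun t => expR (t * a) * cos (t * b)) a.
    apply: is_derive_eq.
    by rewrite !mul0r expR0 cos0 sin0 /GRing.scale /= ; ring.
  by have := is_derive_seq d; rewrite !mul0r expR0 cos0 mul1r.
have d : is_derive (0 : R) (1 : R) (fun t => expR (t * a) * sin (t * b)) b.
  apply: is_derive_eq.
  by rewrite !mul0r expR0 cos0 sin0 /GRing.scale /= ; ring.
by have := is_derive_seq d; rewrite !mul0r expR0 sin0 mul1r.
Qed.

Lemma cvg_nat_mul_csin w : (m%:R * csin (w / m%:R) : R[i]^o) @[m --> \oo] --> (w : R[i]^o).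
Proof.
have h1 := @cvg_nat_mul_cexp_sub1 ('i%C * w); have h2 := @cvg_nat_mul_cexp_sub1 (- ('i%C * w)).
have hB : (m%:R * (cexp ('i%C * w / m%:R) - 1) - m%:R * (cexp (- ('i%C * w) / m%:R) - 1) : R[i]^o)
    @[m --> \oo] --> ('i%C * w - - ('i%C * w) : R[i]^o) by exact: (cvgB h1 h2).
apply: (cvg_cong (cvgM (cvg_cst (((2 * 'i%C)^-1 : R[i]^o))) hB)) => [m|] /=.
  by rewrite /csin (mulrA _ w) mulNr; field; rewrite i_neq0.
by rewrite opprK; field; rewrite i_neq0.
Qed.

(** With s = t/2, the mean value theorem gives sin s >= s cos s, so sin t = 2 sin s cos s >= t cos^2
    s, and cos t >= 0 means cos^2 s >= 1/2. *)
Lemma sin_ge_half (t : R) : 0 <= t <= pi / 2 -> t / 2 <= sin t.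
Proof.
move=> /andP[t0 t1]; set s := t / 2.
have s0 : 0 <= s by rewrite divr_ge0.
have h : s * cos s <= sin s.
  have [|c] := @MVT_segment R sin cos 0 s s0 (fun x _ => is_derive_sin x).
    by apply: continuous_subspaceT => x; exact: continuous_sin.
  rewrite in_itv /= => /andP[c0 cs]; rewrite sin0 !subr0 => ->.
  rewrite mulrC ler_wpM2r //.
  have pi2 := pi_ge2 R.
  have [->//|csn] := eqVneq s c.
  have cs' : c < s by rewrite lt_neqAle eq_sym csn cs.
  by apply/ltW; rewrite ltr_cos ?in_itv /= ?c0 ?s0 //=; rewrite /s in cs *; lra.
have ht : t = s + s by rewrite /s; field.
have ct : 0 <= cos t by apply: cos_ge0_pihalf; have := pi_ge0 R; lra.
have cs0 : 0 <= cos s by apply: cos_ge0_pihalf; have := pi_ge0 R; rewrite /s; lra.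
rewrite ht sinD; rewrite ht cosD in ct.
have := cos2Dsin2 s; have := ler_wpM2r cs0 h.
rewrite !expr2 in ct * => h1 h2.
nra.
Qed.
End Trig.

(** * Partial fractions of one factor *)

(** [h] and [V] solve the same second-order recurrence and vanish at 0, so they are proportional;
    the boundary condition at the top fixes the ratio. The result is cross-multiplied because [V 1]
    may vanish. *)
Lemma discrete_oscillator (K : idomainType) (h V : nat -> K) (c : K) (m l : nat) :
  h 0%N = 0 -> V 0%N = 0 ->
  (forall i, (i < m)%N -> h i.+2 = 2 * c * h i.+1 - h i) ->
  (forall i, V i.+2 = 2 * c * V i.+1 - V i) ->
  c * h m.+1 - h m = 1 -> (l <= m.+1)%N ->
  h l * V 1%N * (c * V m.+1 - V m) = V l * V 1%N.
Proof.
move=> h0 V0 hh hV hm lm.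
have E i : (i <= m)%N -> h i * V 1%N = h 1%N * V i /\ h i.+1 * V 1%N = h 1%N * V i.+1.
  elim: i => [|i IH] im; first by rewrite h0 V0 mul0r mulr0.
  have [IH1 IH2] := IH (ltnW im); split=> //.
  have -> : h i.+2 * V 1%N = 2 * c * (h i.+1 * V 1%N) - h i * V 1%N by rewrite hh //; ring.
  by rewrite hV IH2 IH1; ring.
have El : h l * V 1%N = h 1%N * V l.
  by case: l lm => [_|l]; [have [] := E 0%N (leq0n _)|rewrite ltnS => /E []].
have [Em Em1] := E m (leqnn m).
have F : h 1%N * (c * V m.+1 - V m) = V 1%N.
  by rewrite mulrBr mulrCA -Em1 -Em mulrA -mulrBl hm mul1r.
by rewrite El mulrAC F mulrC.
Qed.

(** * Finite sine sums over the nodes *)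

Section Factor.
Variable R : realType.

Lemma sin_nat_pi (l : nat) : sin (l%:R * pi) = 0 :> R.
Proof.
elim: l => [|l IH]; first by rewrite mul0r sin0.
by rewrite -natr1 mulrDl mul1r sinD IH sinpi mul0r mulr0 addr0.
Qed.

Lemma sin_cos_odd_pihalf (k : nat) :
  sin ((2 * k + 1)%:R * (pi / 2)) = (-1) ^+ k :> R /\
  cos ((2 * k + 1)%:R * (pi / 2)) = 0 :> R.
Proof.
elim: k => [|k [IH1 IH2]]; first by rewrite mul1r sin_pihalf cos_pihalf expr0.
have -> : (2 * k.+1 + 1)%:R * (pi / 2) = (2 * k + 1)%:R * (pi / 2) + pi :> R.
  by field.
by rewrite (sinD _ pi) (cosD _ pi) IH1 IH2 sinpi cospi exprS; split; ring.
Qed.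

(** Since 2 cos(al) sin((2k+1) al) = sin((2k+2) al) + sin(2k al), the alternating sum telescopes. *)
Lemma alternating_sin_sum (al : R) (m : nat) :
  2 * cos al * (\sum_(k < m) (-1) ^+ k * sin ((2 * k + 1)%:R * al)) =
  - (-1) ^+ m * sin ((2 * m)%:R * al).
Proof.
elim: m => [|m IH]; first by rewrite big_ord0 mulr0 muln0 mul0r sin0 mulr0.
rewrite big_ord_recr /= mulrDr IH exprS.
have -> : (2 * m.+1)%:R * al = (2 * m)%:R * al + al + al by ring.
have -> : (2 * m + 1)%:R * al = (2 * m)%:R * al + al by ring.
rewrite !sinD !cosD.
apply/subr0_eq.
transitivity ((-1) ^+ m * sin ((2 * m)%:R * al) * (cos al ^+ 2 + sin al ^+ 2 - 1)); first by ring.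
by rewrite cos2Dsin2 subrr mulr0.
Qed.

(** For k < m these are the zeros of cos(m phi) in (0, pi); their cosines are the Chebyshev
    nodes. *)
Definition node (m k : nat) : R := (2 * k + 1)%:R * (pi / (2 * m%:R)).

(** At al = l pi/(2m) the telescoped value is a multiple of sin(l pi) = 0, and l < m keeps al below
    pi/2, where the cosine is positive. This makes the recurrence of [node_sum] homogeneous. *)
Lemma alternating_node_sum (m l : nat) : (l < m)%N ->
  \sum_(k < m) (-1) ^+ k * sin (l%:R * node m k) = 0 :> R.
Proof.
move=> lm; pose al : R := l%:R * (pi / (2 * m%:R)).
have m0 : 0 < m%:R :> R by rewrite ltr0n; case: m lm {al}.
have := alternating_sin_sum al m.
have -> : (2 * m)%:R * al = l%:R * pi :> R.
  by rewrite /al; field; rewrite gt_eqF.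
rewrite sin_nat_pi mulr0 => /eqP; rewrite mulf_eq0 => /orP[|/eqP h].
  rewrite mulf_eq0 pnatr_eq0 /= gt_eqF // cos_gt0_pihalf //.
  have al0 : 0 <= al by rewrite mulr_ge0 // divr_ge0 ?pi_ge0 // mulr_ge0 // ltW.
  have -> : al = (l%:R / m%:R) * (pi / 2) by rewrite /al; field; rewrite gt_eqF.
  have p2 : 0 < pi / 2 :> R by rewrite divr_gt0 ?pi_gt0.
  rewrite (lt_le_trans (y := 0)) ?oppr_lt0 //=; last first.
    by rewrite mulr_ge0 ?(ltW p2) // divr_ge0 // ltW.
  by rewrite gtr_pMl // ltr_pdivrMr // mul1r ltr_nat.
by rewrite -[RHS]h; apply: eq_bigr => k _; rewrite /al /node; congr (_ * sin _); ring.
Qed.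

(** These values supply the boundary condition of the recurrence: c times the top term minus the one
    below has (c - cos)/(c - cos) = 1 in every summand. *)
Lemma node_full (m k : nat) :
  (-1) ^+ k * sin (m.+1%:R * node m.+1 k) = 1 :> R /\
  (-1) ^+ k * sin (m%:R * node m.+1 k) = cos (node m.+1 k) :> R.
Proof.
have [hs hc] := sin_cos_odd_pihalf k.
have E : m.+1%:R * node m.+1 k = (2 * k + 1)%:R * (pi / 2).
  by rewrite /node; field; rewrite addr_eq0 gt_eqF// (lt_le_trans (ltrN10 _)).
have E2 : m%:R * node m.+1 k = m.+1%:R * node m.+1 k - node m.+1 k.
  by rewrite -natr1 mulrDl mul1r addrK.
rewrite E2 sinB E hs hc mul0r subr0 mulrA -exprMn mulrNN mulr1 expr1n mul1r; split => //.
Qed.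

(** This is h(l) divided by [m], which normalizes the boundary value to 1. *)
Definition node_sum (c : R[i]) (m l : nat) : R[i] :=
  m%:R^-1 * \sum_(k < m) ((-1) ^+ k * sin (l%:R * node m k))%:C / (c - (cos (node m k))%:C).

Lemma node_sum_oscillator (c : R[i]) (V : nat -> R[i]) (m l : nat) :
  (forall k, (k < m.+1)%N -> c != (cos (node m.+1 k))%:C) ->
  V 0%N = 0 -> (forall i, V i.+2 = 2 * c * V i.+1 - V i) -> (l <= m.+1)%N ->
  node_sum c m.+1 l * V 1%N * (c * V m.+1 - V m) = V l * V 1%N.
Proof.
move=> cn V0 hV lm.
have m0 : m.+1%:R != 0 :> R[i] by rewrite pnatr_eq0.
apply: discrete_oscillator => //.
- rewrite /node_sum big1 ?mulr0 // => k _.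
  by rewrite mul0r sin0 mulr0 rmorph0 mul0r.
- move=> i im.
  rewrite /node_sum mulrCA -mulrBr.
  (* Writing 2 cos(phi_k) as 2c - 2(c - cos(phi_k)) cancels a denominator and leaves twice the
     alternating sum, which is zero. *)
  transitivity (m.+1%:R^-1 * (2 * c * (\sum_(k < m.+1)
    ((-1) ^+ k * sin (i.+1%:R * node m.+1 k))%:C / (c - (cos (node m.+1 k))%:C)) -
     (\sum_(k < m.+1)
    ((-1) ^+ k * sin (i%:R * node m.+1 k))%:C / (c - (cos (node m.+1 k))%:C)) -
    2 * (\sum_(k < m.+1) (-1) ^+ k * sin (i.+1%:R * node m.+1 k))%:C)).
    congr (_ * _); rewrite rmorph_sum !mulr_sumr -!sumrB; apply: eq_bigr => k _.
    have cn0 : c - (cos (node m.+1 k))%:C != 0 by rewrite subr_eq0 cn.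
    have -> : sin (i.+2%:R * node m.+1 k) =
        2 * cos (node m.+1 k) * sin (i.+1%:R * node m.+1 k) - sin (i%:R * node m.+1 k).
      have -> : i.+2%:R * node m.+1 k = i.+1%:R * node m.+1 k + node m.+1 k by ring.
      have -> : i%:R * node m.+1 k = i.+1%:R * node m.+1 k - node m.+1 k by ring.
      by rewrite sinD sinB; ring.
    rewrite !(rmorphM, rmorphB, rmorph_nat) /=.
    by field.
  by rewrite alternating_node_sum // rmorph0 mulr0 subr0.
- rewrite /node_sum mulrCA -mulrBr mulr_sumr -sumrB.
  rewrite (eq_bigr (fun=> 1)) => [|k _].
    by rewrite sumr_const card_ord mulVf.
  have [-> ->] := node_full m k.
  have cn0 : c - (cos (node m.+1 k))%:C != 0 by rewrite subr_eq0 cn.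
  by rewrite rmorph1; field.
Qed.
End Factor.

(** * Limits and lower bounds of the scaled denominators *)

Section Factor.
Variable R : realType.

Lemma cvg_cexp_scale (f : nat -> R) (r : R) (w : R[i]) :
  f m @[m --> \oo] --> r ->
  (cexp ((f m)%:C * w) : R[i]^o) @[m --> \oo] --> (cexp (r%:C * w) : R[i]^o).
Proof.
case: w => a b fr.
have fa : f m * a @[m --> \oo] --> r * a by apply: cvgM fr (cvg_cst _).
have fb : f m * b @[m --> \oo] --> r * b by apply: cvgM fr (cvg_cst _).
have ea := cvg_comp _ _ fa (@continuous_expR R (r * a)).
have cb := cvg_comp _ _ fb (@continuous_cos R (r * b)).
have sb := cvg_comp _ _ fb (@continuous_sin R (r * b)).
apply: cvg_ReIm.
  apply: (cvg_cong (cvgM ea cb)) => [m|] /=; rewrite /cexp /= ?(mul0r, subr0, addr0); ring.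
apply: (cvg_cong (cvgM ea sb)) => [m|] /=; rewrite /cexp /= ?(mul0r, subr0, addr0, add0r); ring.
Qed.

Lemma cvg_csin_scale (f : nat -> R) (r : R) (w : R[i]) :
  f m @[m --> \oo] --> r ->
  (csin ((f m)%:C * w) : R[i]^o) @[m --> \oo] --> (csin (r%:C * w) : R[i]^o).
Proof.
move=> fr.
have h1 := @cvg_cexp_scale _ _ ('i%C * w) fr.
have h2 := @cvg_cexp_scale _ _ (- ('i%C * w)) fr.
have hB : (cexp ((f m)%:C * ('i%C * w)) - cexp ((f m)%:C * - ('i%C * w)) : R[i]^o)
  @[m --> \oo] --> (cexp (r%:C * ('i%C * w)) - cexp (r%:C * - ('i%C * w)) : R[i]^o).
  exact: (cvgB h1 h2).
apply: (cvg_cong (cvgM hB (cvg_cst (((2 * 'i%C)^-1 : R[i]^o))))) => [m|] /=;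
by rewrite /csin !mulrN !(mulrCA _ 'i%C).
Qed.

Lemma cvg_nat_sqr_mul_sub_ccos (w : R[i]) :
  (m%:R ^+ 2 * (1 - ccos (w / m%:R)) : R[i]^o) @[m --> \oo] --> (w ^+ 2 / 2 : R[i]^o).
Proof.
have h := @cvg_nat_mul_csin R (w / 2).
apply: (cvg_cong (cvgM (cvgM h h) (cvg_cst ((2 : R[i]^o))))) => [m|] /=.
  by rewrite ccos_half (mulrAC w); ring.
by field.
Qed.

(** The denominator cos u - cos(phi_k) with u = pi z/(2m); the factor m^2 gives it a finite limit
    for fixed [k]. *)
Definition node_gap (z : R[i]) (m k : nat) : R[i] :=
  m%:R ^+ 2 * (ccos (z * (pi / 2)%:C / m%:R) - (cos (node R m k))%:C).

Lemma cos_node (m k : nat) :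
  (cos (node R m k))%:C = ccos ((2 * k + 1)%:R * (pi / 2)%:C / m%:R).
Proof.
rewrite -ccos_real; congr ccos; rewrite /node.
have nC n : (n%:R : R[i]) = (n%:R : R)%:C by rewrite rmorph_nat.
rewrite !nC -fmorphV -!(rmorphM (real_complex R)); congr (_%:C); rewrite invfM; ring.
Qed.

Lemma cvg_node_gap (z : R[i]) (k : nat) :
  (node_gap z m k : R[i]^o) @[m --> \oo] -->
  ((pi ^+ 2 / 8)%:C * ((2 * k + 1)%:R ^+ 2 - z ^+ 2) : R[i]^o).
Proof.
have h1 := @cvg_nat_sqr_mul_sub_ccos ((2 * k + 1)%:R * (pi / 2)%:C).
have h2 := @cvg_nat_sqr_mul_sub_ccos (z * (pi / 2)%:C).
have hB : (m%:R ^+ 2 * (1 - ccos ((2 * k + 1)%:R * (pi / 2)%:C / m%:R)) -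
    m%:R ^+ 2 * (1 - ccos (z * (pi / 2)%:C / m%:R)) : R[i]^o) @[m --> \oo] -->
    (((2 * k + 1)%:R * (pi / 2)%:C) ^+ 2 / 2 - (z * (pi / 2)%:C) ^+ 2 / 2 : R[i]^o).
  exact: (cvgB h1 h2).
apply: (cvg_cong hB) => [m|].
  by rewrite /node_gap cos_node; ring.
rewrite !(rmorphM, rmorphXn, fmorphV, rmorph_nat) /=; by field.
Qed.

Lemma cvgC_bounded (f : nat -> R[i]^o) (l : R[i]^o) :
  f m @[m --> \oo] --> l -> exists B : R, forall m, normc (f m) <= B.
Proof.
move=> /cvg_normcP h.
have hb : cvgn (fun m => normc (f m - l) : R) by apply/cvg_ex; exists 0.
have pf : ProperFilter (globally [set: nat]) by apply: (@globally_properfilter _ _ 0%N).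
have [M hM] := (ex_bound _).1 (cvg_seq_bounded hb).
exists (normc l + M) => m.
apply: le_trans (normc_le_dist _ l) _; rewrite lerD2l normc_distC.
by apply: le_trans (hM m I); exact: ler_norm.
Qed.

(** This is the domination needed for [tannery]. The part m^2 (1 - cos(phi_k)) = 2 (m
    sin(phi_k/2))^2 is at least (2k+1)^2/8 by [sin_ge_half], while the part depending on [z] is
    bounded by some [B], at most k/16 once k >= 16 B. *)
Lemma node_gap_ge (z : R[i]) :
  exists K, forall m k, (K <= k < m)%N ->
    (16%:R)^-1 * k.+1%:R ^+ 2 <= normc (node_gap z m k) :> R.
Proof.
have h := @cvg_nat_sqr_mul_sub_ccos (z * (pi / 2)%:C).
have [B hB] : exists B : R, forall m : nat,
    normc (m%:R ^+ 2 * (1 - ccos (z * (pi / 2)%:C / m%:R))) <= B.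
  exact: cvgC_bounded h.
have [K hK] := nat_bound (16 * B).
exists K => m k /andP[Kk km].
have -> : node_gap z m k = m%:R ^+ 2 * (1 - cos (node R m k))%:C -
    m%:R ^+ 2 * (1 - ccos (z * (pi / 2)%:C / m%:R)).
  by rewrite /node_gap rmorphB rmorph1; ring.
apply: le_trans (normc_subr_ge _ _).
rewrite normcM normcX normc_nat normc_real ger0_norm ?subr_ge0 ?cos_le1 //.
have hBm := hB m; have hKk := hK k Kk.
have m0 : 0 < m%:R :> R by rewrite ltr0n; case: (m) km.
have nE : node R m k / 2 = (2 * k + 1)%:R / (2 * m%:R) * (pi / 2).
  by rewrite /node; field; rewrite gt_eqF.
have n0 : 0 <= node R m k / 2.
  by rewrite nE mulr_ge0 // divr_ge0 ?pi_ge0 // mulr_ge0 // ltW.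
have n1 : node R m k / 2 <= pi / 2.
  rewrite nE ler_piMl ?divr_ge0 ?pi_ge0 //.
  rewrite ler_pdivrMr ?mulr_gt0 // mul1r -natrM ler_nat; lia.
have s1 : node R m k / 2 / 2 <= sin (node R m k / 2) by apply: sin_ge_half; rewrite n0.
have hz (r : R) : r%:C / 2 = (r / 2)%:C by rewrite rmorphM fmorphV rmorph_nat.
have -> : 1 - cos (node R m k) = 2 * sin (node R m k / 2) ^+ 2.
  apply: complexI; rewrite rmorphB rmorph1 /= -ccos_real ccos_half hz csin_real.
  by rewrite !expr2 !(rmorphM, rmorph_nat).
have s2 : (2 * k + 1)%:R / 4 <= m%:R * sin (node R m k / 2).
  apply: le_trans (ler_wpM2l (ltW m0) s1).
  have -> : m%:R * (node R m k / 2 / 2) = (2 * k + 1)%:R / 8 * pi.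
    by rewrite nE; field; rewrite gt_eqF.
  have := ler_wpM2l _ (pi_ge2 R) => /(_ ((2 * k + 1)%:R / 8)) h1.
  by apply: le_trans (h1 _); [lra|rewrite divr_ge0].
have s3 : ((2 * k + 1)%:R / 4) ^+ 2 <= (m%:R * sin (node R m k / 2)) ^+ 2.
  by rewrite lerXn2r // nnegrE ?divr_ge0 // (le_trans _ s2) ?divr_ge0.
rewrite (natrD _ (2 * k)) natrM in s3; rewrite -[k.+1%:R]natr1.
have : 0 <= k%:R :> R by [].
move: (k%:R : R) hKk s3 => u hKk s3 u0.
rewrite [X in _ <= X]exprMn in s3.
move: (normc _) hBm => b hBm.
move: (m%:R ^+ 2 : R) s3 => mm s3.
move: (sin _ ^+ 2) s3 => ss s3.
have u2 : 0 <= u ^+ 2 by apply: sqr_ge0.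
rewrite (mulrCA mm).
move: (mm * ss) s3 => ms s3.
lra.
Qed.
End Factor.

(** * Passage from finite sums to the series of one factor *)

Section Factor.
Variable R : realType.
Implicit Types (z : R[i]) (th : R).

Definition osc (th : R) (k : nat) : R := (-1) ^+ k * sin ((2 * k + 1)%:R * th).

Lemma osc_le1 th k : `|osc th k| <= 1.
Proof. by rewrite /osc normrM normrX normrN1 expr1n mul1r sin_max. Qed.

(** For nonnegative [th], the largest l with l pi/(2m) at most [th] (m > 0). The finite identity
    lives at such angles, so [th] is approached through them. *)
Definition grid_index (th : R) (m : nat) : nat := Num.truncn (m%:R * (2 * th / pi)).
Definition grid_point (th : R) (m : nat) : R := (grid_index th m)%:R * (pi / (2 * m%:R)).

Lemma grid_index_le th m : 0 <= th <= pi / 2 -> (grid_index th m <= m)%N.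
Proof.
move=> /andP[th0 th1]; rewrite -(ler_nat R).
have p0 := pi_gt0 R.
have /truncn_itv/andP[h _] : 0 <= m%:R * (2 * th / pi).
  by rewrite mulr_ge0 // divr_ge0 ?pi_ge0 // mulr_ge0.
apply: le_trans h _; rewrite ler_piMr // ler_pdivrMr //; lra.
Qed.

Lemma cvg_grid_point th : 0 <= th -> grid_point th m @[m --> \oo] --> th.
Proof.
move=> th0; have p0 := pi_gt0 R.
have h : th - pi / 2 * m.+1%:R^-1 @[m --> \oo] --> th.
  apply: (cvg_cong (cvgB (cvg_cst th) (cvgM (cvg_cst (pi / 2)) (@cvg_harmonic R)))) => [//|].
  by rewrite mulr0 subr0.
rewrite -(cvg_shiftS (grid_point th)).
apply: (squeeze_cvgr _ h (cvg_cst th)).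
apply: nearW => m /=.
have m0 : 0 < m.+1%:R :> R by [].
have /truncn_itv/andP[h1 h2] : 0 <= m.+1%:R * (2 * th / pi).
  by rewrite mulr_ge0 // divr_ge0 ?pi_ge0 // mulr_ge0.
rewrite /grid_point /grid_index.
rewrite -[X in _ < X]natr1 in h2.
set l := (Num.truncn _)%:R in h1 h2 *.
have q0 : 0 < pi / (2 * m.+1%:R) :> R by rewrite divr_gt0 // mulr_gt0.
have E : th = m.+1%:R * (2 * th / pi) * (pi / (2 * m.+1%:R)).
  have F (p n : R) : p != 0 -> n != 0 -> th = n * (2 * th / p) * (p / (2 * n)).
    by move=> pn nn; field; rewrite pn nn.
  by apply: F; rewrite gt_eqF.
have E2 : pi / 2 * m.+1%:R^-1 = 1 * (pi / (2 * m.+1%:R)) :> R.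
  by rewrite mul1r invfM mulrA.
rewrite E2 [X in X - _]E [X in _ && (_ <= X)]E -mulrBl !ler_pM2r // h1 andbT.
by rewrite lerBlDr ltW.
Qed.

Lemma cvg_osc_grid th k : 0 <= th ->
  osc (grid_point th m) k @[m --> \oo] --> osc th k.
Proof.
move=> th0; apply: cvgM; first exact: cvg_cst.
have h : (2 * k + 1)%:R * grid_point th m @[m --> \oo] --> (2 * k + 1)%:R * th.
  by apply: cvgM; [exact: cvg_cst|exact: cvg_grid_point].
exact: (cvg_comp _ _ h (@continuous_sin R _)).
Qed.

Lemma osc_grid th m k :
  osc (grid_point th m) k = (-1) ^+ k * sin ((grid_index th m)%:R * node R m k).
Proof. by rewrite /osc /grid_point /node mulrCA. Qed.

(** The value 0 from k = m on lets one bound, uniform in [m], hold for all large [k]. *)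
Definition grid_term (th : R) (z : R[i]) (m k : nat) : R[i] :=
  if (k < m)%N then (osc (grid_point th m) k)%:C / node_gap z m k else 0.

Lemma cvg_grid_term th z k : 0 <= th -> (2 * k + 1)%:R ^+ 2 != z ^+ 2 ->
  (grid_term th z m k : R[i]^o) @[m --> \oo] -->
  ((osc th k)%:C / ((pi ^+ 2 / 8)%:C * ((2 * k + 1)%:R ^+ 2 - z ^+ 2)) : R[i]^o).
Proof.
move=> th0 kz.
have n0 : (pi ^+ 2 / 8)%:C * ((2 * k + 1)%:R ^+ 2 - z ^+ 2) != 0 :> R[i].
  rewrite mulf_neq0 // ?subr_eq0 //.
  by rewrite (inj_eq (@complexI R) _ 0) gt_eqF // divr_gt0 // exprn_gt0 // pi_gt0.
have h : ((osc (grid_point th m) k)%:C * (node_gap z m k)^-1 : R[i]^o) @[m --> \oo] -->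
    ((osc th k)%:C / ((pi ^+ 2 / 8)%:C * ((2 * k + 1)%:R ^+ 2 - z ^+ 2)) : R[i]^o).
  by apply: cvgM; [exact: (cvg_realC (cvg_osc_grid th0))|by apply: cvgV; [exact: n0|exact: cvg_node_gap]].
apply: cvg_trans h; apply: near_eq_cvg; near=> m.
by rewrite /grid_term ifT //; near: m; exact: nbhs_infty_gt.
Unshelve. all: by end_near. Qed.

(** Uniformity in [k] comes from [node_gap_ge] for large [k]; the finitely many others have nonzero
    limits. *)
Lemma near_node_gap_neq0 z :
  (forall k, (2 * k + 1)%:R ^+ 2 != z ^+ 2) ->
  \forall m \near \oo, forall k, (k < m)%N -> node_gap z m k != 0.
Proof.
move=> hz; have [K hK] := node_gap_ge z.
have hk k : \forall m \near \oo, node_gap z m k != 0.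
  have n0 : (pi ^+ 2 / 8)%:C * ((2 * k + 1)%:R ^+ 2 - z ^+ 2) != 0 :> R[i].
    rewrite mulf_neq0 // ?subr_eq0 //.
    by rewrite (inj_eq (@complexI R) _ 0) gt_eqF // divr_gt0 // exprn_gt0 // pi_gt0.
  exact: (cvgr_neq0 _ (cvg_node_gap (z := z) (k := k)) n0).
have hK' : \forall m \near \oo, forall k, (k < K)%N -> node_gap z m k != 0.
  elim: (K) => [|K' IH]; first by apply: nearW.
  near=> m => k; rewrite ltnS leq_eqVlt => /orP[/eqP ->|].
    by near: m; exact: hk.
  by move: k; near: m.
near=> m => k km; have [kK|Kk] := ltnP k K.
  by move: k kK {km}; near: m.
rewrite -normc_gt0; apply: lt_le_trans (hK m k _); last by rewrite Kk.
by rewrite mulr_gt0 // exprn_gt0.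
Unshelve. all: by end_near. Qed.

Lemma sum_grid_term th z m : 
  \sum_(k < m) grid_term th z m k =
  m%:R^-1 * node_sum (ccos (z * (pi / 2)%:C / m%:R)) m (grid_index th m).
Proof.
rewrite /node_sum mulrA mulr_sumr; apply: eq_bigr => k _.
by rewrite /grid_term ltn_ord osc_grid /node_gap -expr2 invfM exprVn mulrCA.
Qed.

(** This is [node_sum_oscillator] with V i = sin(i u). It stays multiplied out because sin u may
    vanish, and is grouped into factors m sin u, which converge. *)
Lemma grid_sum_formula th z m :
  0 <= th <= pi / 2 -> (forall k, (k < m)%N -> node_gap z m k != 0) -> (0 < m)%N ->
  (\sum_(k < m) grid_term th z m k) * (m%:R * csin (z * (pi / 2)%:C / m%:R)) ^+ 2 *
    ccos (z * (pi / 2)%:C) =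
  csin ((grid_point th m)%:C * z) * (m%:R * csin (z * (pi / 2)%:C / m%:R)).
Proof.
case: m => // m hth hn _.
rewrite sum_grid_term; set u := z * (pi / 2)%:C / m.+1%:R.
have m0 : m.+1%:R != 0 :> R[i] by rewrite pnatr_eq0.
have cn k : (k < m.+1)%N -> ccos u != (cos (node R m.+1 k))%:C.
  by move=> /hn; rewrite /node_gap mulf_eq0 negb_or subr_eq0 => /andP[].
have V0 : csin (0%:R * u) = 0 by rewrite mul0r csin0.
have hV i : csin (i.+2%:R * u) = 2 * ccos u * csin (i.+1%:R * u) - csin (i%:R * u).
  have -> : i.+2%:R * u = i.+1%:R * u + u by ring.
  have -> : i%:R * u = i.+1%:R * u - u by ring.
  by rewrite !csinD ccosN csinN; ring.
have := node_sum_oscillator cn V0 hV (grid_index_le m.+1 hth).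
have -> : ccos u * csin (m.+1%:R * u) - csin (m%:R * u) = csin u * ccos (m.+1%:R * u).
  have -> : m%:R * u = m.+1%:R * u - u by ring.
  by rewrite !csinD ccosN csinN; ring.
have -> : m.+1%:R * u = z * (pi / 2)%:C by rewrite /u; field.
have -> : (grid_index th m.+1)%:R * u = (grid_point th m.+1)%:C * z.
  have nC n : (n%:R : R[i]) = (n%:R : R)%:C by rewrite rmorph_nat.
  rewrite /u /grid_point !nC -fmorphV mulrC -!mulrA -!(rmorphM (real_complex R)) mulrC.
  by congr (_%:C * _); rewrite invfM; ring.
rewrite mul1r => h.
set n := node_sum _ _ _ in h *.
transitivity (m.+1%:R * (n * csin u * (csin u * ccos (z * (pi / 2)%:C)))); first by field.
by rewrite h; ring.
Qed.

(** At z = 0 the sine solution degenerates; with c = 1 the recurrence has the solution V i = i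
    instead. *)
Lemma grid_sum_formula0 th m :
  0 <= th <= pi / 2 -> (forall k, (k < m)%N -> node_gap (0 : R[i]) m k != 0) -> (0 < m)%N ->
  (\sum_(k < m) grid_term th 0 m k) = (grid_point th m * (2 / pi))%:C.
Proof.
case: m => // m hth hn _.
rewrite sum_grid_term !mul0r ccos0.
have m0 : m.+1%:R != 0 :> R[i] by rewrite pnatr_eq0.
have cn k : (k < m.+1)%N -> 1 != (cos (node R m.+1 k))%:C :> R[i].
  by move=> /hn; rewrite /node_gap !mul0r ccos0 mulf_eq0 negb_or subr_eq0 => /andP[].
have hV (i : nat) : i.+2%:R = 2 * 1 * i.+1%:R - i%:R :> R[i] by ring.
have := node_sum_oscillator cn (V := fun i => i%:R) erefl hV (grid_index_le m.+1 hth).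
have -> : 1 * m.+1%:R - m%:R = 1 :> R[i] by ring.
rewrite !mulr1 => ->; rewrite /grid_point.
have nC n : (n%:R : R[i]) = (n%:R : R)%:C by rewrite rmorph_nat.
rewrite !nC -fmorphV -!(rmorphM (real_complex R)); congr (_%:C).
have F (p n l : R) : p != 0 -> n != 0 -> n^-1 * l = l * (p / (2 * n)) * (2 / p).
  by move=> pn nn; field; rewrite pn nn.
by apply: F; rewrite ?pnatr_eq0 // gt_eqF // pi_gt0.
Qed.

(** [tannery] shows that the finite sums and the limiting series share a limit; its value is found
    afterwards from the closed forms. *)
Lemma cvg_grid_sum th z : 0 <= th -> (forall k, (2 * k + 1)%:R ^+ 2 != z ^+ 2) ->
  exists2 T : R[i]^o,
    (\sum_(k < m) grid_term th z m k : R[i]^o) @[m --> \oo] --> T &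
    (\sum_(k < m) (osc th k)%:C / ((pi ^+ 2 / 8)%:C * ((2 * k + 1)%:R ^+ 2 - z ^+ 2)) : R[i]^o)
      @[m --> \oo] --> T.
Proof.
move=> th0 hz; have [K hK] := node_gap_ge z.
have [|c h] := @tannery R (fun n => 16 * (n.+1%:R ^+ 2)^-1) (grid_term th z) _ K
  (@is_cvg_series_inv_sqr R 16) _ (fun k => cvg_grid_term th0 (hz k)).
  move=> m k Kk; rewrite /grid_term; case: ifP => [km|_]; last first.
    by rewrite normc0 mulr_ge0 // invr_ge0 sqr_ge0.
  rewrite normcM normc_real normcV -[leRHS]mul1r; apply: ler_pM => //.
  - by rewrite invr_ge0 normc_ge0.
  - exact: osc_le1.
  - have {}hK := hK m k _; rewrite Kk km in hK; have {}hK := hK isT.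
    rewrite -[16]invrK -invfM lef_pV2 // posrE ?(lt_le_trans _ hK) //;
    by rewrite mulr_gt0 // exprn_gt0.
eexists; first exact: h.
by apply: (cvg_cong c) => [m|//]; rewrite /series /= big_mkord.
Qed.

Lemma cvg_near_unique (f g : nat -> R[i]^o) (l l' : R[i]^o) :
  f m @[m --> \oo] --> l -> g m @[m --> \oo] --> l' ->
  (\forall m \near \oo, f m = g m) -> l = l'.
Proof.
move=> fl gl fg.
have gl' : f m @[m --> \oo] --> l'.
  by apply: cvg_trans gl; apply: near_eq_cvg; apply: filterS fg => m ->.
rewrite -(cvg_lim (@norm_hausdorff _ _) fl).
by rewrite -(cvg_lim (@norm_hausdorff _ _) gl').
Qed.

(** The last clause is the closed form with denominators cleared; it is empty at z = 0, where the
    middle clause gives the value. *)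
Lemma cvg_odd_series th z :
  0 <= th <= pi / 2 -> (forall k, (2 * k + 1)%:R ^+ 2 != z ^+ 2) ->
  exists S : R[i]^o,
    [/\ (\sum_(k < m) (osc th k)%:C / ((2 * k + 1)%:R ^+ 2 - z ^+ 2) : R[i]^o)
          @[m --> \oo] --> S,
        z = 0 -> S = (pi / 4 * th)%:C &
        S * 4 * z * ccos (z * (pi / 2)%:C) = pi%:C * csin (th%:C * z)].
Proof.
move=> hth hz; have /andP[th0 th1] := hth; have p0 := pi_gt0 R.
have [T hT hS] := cvg_grid_sum th0 hz.
have q0 : (pi ^+ 2 / 8)%:C != 0 :> R[i].
  by rewrite (inj_eq (@complexI R) _ 0) gt_eqF // divr_gt0 // exprn_gt0.
exists ((pi ^+ 2 / 8)%:C * T); split.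
- apply: (cvg_cong (cvgM (cvg_cst ((pi ^+ 2 / 8)%:C : R[i]^o)) hS)) => [m|//] /=.
  rewrite mulr_sumr; apply: eq_bigr => k _; by rewrite invfM mulrCA mulVKf.
- move=> z0; rewrite z0 in hz hT.
  have -> : T = (th * (2 / pi))%:C.
    apply: (cvg_near_unique hT (cvg_realC (cvgM (cvg_grid_point th0) (cvg_cst (2 / pi))))).
    near=> m; apply: grid_sum_formula0 => //; last by near: m; exact: nbhs_infty_gt.
    by near: m; exact: near_node_gap_neq0.
  rewrite -rmorphM; congr (_%:C).
  have F (p : R) : p != 0 -> p ^+ 2 / 8 * (th * (2 / p)) = p / 4 * th.
    by move=> pn; field.
  by apply: F; rewrite gt_eqF.
- have [->|z0] := eqVneq z 0; first by rewrite !(mulr0, mul0r) csin0 mulr0.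
  set c := ccos _; set w := z * (pi / 2)%:C in c *.
  have w0 : w != 0.
    by rewrite mulf_neq0 // (inj_eq (@complexI R) _ 0) gt_eqF // divr_gt0.
  have hw := @cvg_nat_mul_csin R w.
  (* The limit of [grid_sum_formula], since m sin(w/m) tends to [w]. *)
  have E : T * w ^+ 2 * c = csin (th%:C * z) * w.
    have h1 : ((\sum_(k < m) grid_term th z m k) * (m%:R * csin (w / m%:R)) ^+ 2 * c : R[i]^o)
        @[m --> \oo] --> (T * w ^+ 2 * c : R[i]^o).
      by apply: (cvgM (cvgM hT (cvgM hw hw)) (cvg_cst _)).
    have h2 : (csin ((grid_point th m)%:C * z) * (m%:R * csin (w / m%:R)) : R[i]^o)
        @[m --> \oo] --> (csin (th%:C * z) * w : R[i]^o).
      by apply: cvgM hw; apply: cvg_csin_scale; exact: cvg_grid_point.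
    apply: (cvg_near_unique h1 h2).
    near=> m; apply: grid_sum_formula => //; last by near: m; exact: nbhs_infty_gt.
    by near: m; exact: near_node_gap_neq0.
  have {}E : T * w * c = csin (th%:C * z).
    by apply: (mulIf w0); rewrite -E; ring.
  rewrite -E /w.
  have -> : (pi ^+ 2 / 8)%:C = pi%:C ^+ 2 / 8 :> R[i].
    by rewrite rmorphM rmorphXn fmorphV rmorph_nat.
  have -> : (pi / 2)%:C = pi%:C / 2 :> R[i].
    by rewrite rmorphM fmorphV rmorph_nat.
  by field.
Unshelve. all: by end_near. Qed.

(** The series at th = pi/2 shows this: a zero of the cosine would force sin(pi z/2) = 0, against
    cos^2 + sin^2 = 1. *)
Lemma ccos_half_pi_neq0 z : (forall k, (2 * k + 1)%:R ^+ 2 != z ^+ 2) ->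
  ccos (z * (pi / 2)%:C) != 0.
Proof.
move=> hz; have p0 := pi_gt0 R.
have [|S [_ _]] := @cvg_odd_series (pi / 2) z _ hz.
  by rewrite lexx divr_ge0 // ltW.
apply: contra_eq_neq => c0; rewrite c0 mulr0 eq_sym mulf_neq0 //.
  by rewrite (inj_eq (@complexI R) _ 0) gt_eqF.
rewrite mulrC; have := ccos2Dcsin2 (z * (pi / 2)%:C).
by rewrite c0 expr0n add0r => h; rewrite -sqrf_eq0 h oner_eq0.
Qed.

Definition coef (th : R) (x : R[i]) (n : nat) : R[i] := 4 / pi%:C * x * (osc th n)%:C.

(** This is [cvg_odd_series] at z/x, because pole - w = x^2 ((2k+1)^2 - (z/x)^2). Any square root
    [z] is allowed, which suits both [sqrtC] and its multiple by i. *)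
Lemma cvg_cauchy_sum_sin_factor th (x a w z : R[i]) :
  `|th| <= pi / 2 -> x != 0 -> (forall n, pole x a n != w) -> z ^+ 2 = w - a ^+ 2 ->
  (cauchy_sum (coef th x) (pole x a) N w : R[i]^o) @[N --> \oo] --> (sin_factor th x z : R[i]^o).
Proof.
move=> hth x0 pw zw; have p0 := pi_gt0 R.
(* Both sides are odd in [th], and the grid approximation is made for nonnegative angles. *)
wlog th0 : th hth / 0 <= th => [H|].
  have [|/ltW thn] := leP 0 th; first exact: H.
  have := H (- th); rewrite normrN oppr_ge0 => /(_ hth thn) h.
  apply: (cvg_cong (cvgN h)) => [N|]; last by rewrite sin_factor_thetaN opprK.
  rewrite /cauchy_sum /= -sumrN; apply: eq_bigr => n _.
  by rewrite /coef /osc mulrN sinN mulrN rmorphN mulrN mulNr opprK.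
rewrite ger0_norm // in hth.
have hz k : (2 * k + 1)%:R ^+ 2 != (z / x) ^+ 2.
  apply: contra_neq (pw k) => h.
  by rewrite /pole h expr_div_n divfK ?expf_neq0 // zw subrK.
have [|S [hS S0 Sz]] := @cvg_odd_series th (z / x) _ hz; first by rewrite th0.
have pC : pi%:C != 0 :> R[i] by rewrite (inj_eq (@complexI R) _ 0) gt_eqF.
apply: (cvg_cong (cvgM (cvg_cst (4 / pi%:C / x : R[i]^o)) hS)) => [N|] /=.
  rewrite /cauchy_sum mulr_sumr; apply: eq_bigr => k _.
  have -> : pole x a k - w = x ^+ 2 * ((2 * k + 1)%:R ^+ 2 - (z / x) ^+ 2).
    by rewrite expr_div_n zw /pole; field.
  rewrite /coef; have : (2 * k + 1)%:R ^+ 2 - (z / x) ^+ 2 != 0 by rewrite subr_eq0.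
  set d := _ - _; move: pi%:C pC => p pC d0.
  by field; rewrite x0 pC d0.
rewrite /sin_factor; have [z0|z0] := eqVneq z 0.
  have -> : S = pi%:C / 4 * th%:C.
    by rewrite S0 ?z0 ?mul0r // !(rmorphM (real_complex R)) /= fmorphV rmorph_nat.
  move: pi%:C pC => p pC.
  by field; rewrite x0 pC.
have zx0 : z / x != 0 by rewrite mulf_neq0 // invr_eq0.
have c0 := ccos_half_pi_neq0 hz.
have -> : pi%:C / (2 * x) * z = z / x * (pi / 2)%:C.
  by rewrite (rmorphM (real_complex R)) fmorphV rmorph_nat /=; move: pi%:C => p; field.
have -> : th%:C / x * z = th%:C * (z / x) by field.
set c := ccos _ in c0 Sz *; move: c c0 Sz => c c0 Sz.
have -> : csin (th%:C * (z / x)) = (pi%:C)^-1 * (S * 4 * (z / x) * c).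
  by rewrite Sz mulKf.
by move: pi%:C pC => p pC; field; rewrite x0 pC c0 z0.
Qed.
End Factor.

(** * Limits of the truncated sums *)

Lemma cvg_prod_cond (R : realType) (T : Type) (F : set_system T) {FF : Filter F}
    (I : finType) (P : pred I) (f : T -> I -> R[i]^o) (l : I -> R[i]^o) :
  (forall i, P i -> (f x i : R[i]^o) @[x --> F] --> l i) ->
  (\prod_(i | P i) f x i : R[i]^o) @[x --> F] --> (\prod_(i | P i) l i : R[i]^o).
Proof.
move=> h; apply: cvg_big => [|i Pi]; last exact: h.
exact: mul_continuous.
Qed.

(** The coefficients decay like 1/n^2 and every factor is bounded uniformly in both indices, so a
    multiple of 1/(n+1)^2 dominates and [tannery] applies. *)
Lemma cvg_sum_prod (R : realType) (I J : finType) (P : pred J) (c : nat -> R[i]) (C : R)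
    (A : I -> nat -> nat -> R[i]) (A' : I -> nat -> R[i])
    (B : J -> nat -> nat -> R[i]) (B' : J -> nat -> R[i]) :
  (forall n, normc (c n) <= C * (n.+1%:R ^+ 2)^-1) ->
  (forall i, exists b : R, forall L n, normc (A i L n) <= b) ->
  (forall j, P j -> exists b : R, forall L n, normc (B j L n) <= b) ->
  (forall i n, (A i L n : R[i]^o) @[L --> \oo] --> (A' i n : R[i]^o)) ->
  (forall j n, P j -> (B j L n : R[i]^o) @[L --> \oo] --> (B' j n : R[i]^o)) ->
  let l n : R[i]^o := c n * (\prod_i A' i n) * (\prod_(j | P j) B' j n) in
  cvgn (series l) /\
  (\sum_(n < L) c n * (\prod_i A i L n) * (\prod_(j | P j) B j L n) : R[i]^o)
    @[L --> \oo] --> limn (series l).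
Proof.
move=> hc hA hB cA cB l.
have /choice[bA {}hA] := hA.
(* Choosing bounds needs a value at every [j]; off [P] it is the dummy 0. *)
have /choice[bB {}hB] : forall j, exists b : R, P j -> forall L n, normc (B j L n) <= b.
  move=> j; case: (boolP (P j)) => [/hB[b hb]|nP]; first by exists b.
  by exists 0.
pose g n : R := C * (\prod_i bA i) * (\prod_(j | P j) bB j) * (n.+1%:R ^+ 2)^-1.
apply: (@tannery R g (fun L n => c n * (\prod_i A i L n) * (\prod_(j | P j) B j L n)) l 0).
- exact: is_cvg_series_inv_sqr.
- move=> L n _; rewrite !normcM !normc_prod /g.
  have -> : C * \prod_i bA i * \prod_(j | P j) bB j / n.+1%:R ^+ 2 =
    C / n.+1%:R ^+ 2 * \prod_i bA i * \prod_(j | P j) bB j by ring.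
  apply: ler_pM; rewrite ?mulr_ge0 ?normc_ge0 ?prodr_ge0 //.
  + by move=> i _; exact: normc_ge0.
  + by move=> i _; exact: normc_ge0.
  + apply: ler_pM; rewrite ?normc_ge0 ?prodr_ge0 //.
    * by move=> i _; exact: normc_ge0.
    * by apply: ler_prod => i _; rewrite normc_ge0 hA.
  + by apply: ler_prod => j Pj; rewrite normc_ge0 hB.
- move=> n; apply: cvgM; last by apply: cvg_prod_cond => j Pj; exact: cB.
  by apply: cvgM; [exact: cvg_cst|apply: cvg_prod_cond => i _; exact: cA].
Qed.

Lemma normc_coef (R : realType) (th : R) (x : R[i]) n :
  normc (coef th x n) <= normc (4 / pi%:C * x).
Proof.
rewrite /coef normcM normc_real ler_piMr ?normc_ge0 //; exact: osc_le1.
Qed.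

(** The separation of the poles compares the sum with one over gaps, which is at most 4 wherever the
    gaps are centred. *)
Lemma cauchy_sum_pole_bound (R : realType) (th : R) (x x' a a' : R[i]) :
  x != 0 -> x' != 0 -> complex.Im (x / x') != 0 \/ x = x' ->
  (forall n k, pole x a n != pole x' a' k) ->
  exists B : R, forall L n,
    normc (cauchy_sum (coef th x') (pole x' a') L (pole x a n)) <= B.
Proof.
move=> x0 x'0 xx pp; have [c c0 hc] := pole_separation x0 x'0 xx pp.
exists (normc (4 / pi%:C * x') / c * 4) => L n.
apply: (@normc_cauchy_sum_le _ _ _ _ (fun k => (gap k n).+1%:R ^+ 2)) => //.
- exact: normc_ge0.
- exact: normc_coef.
- exact: sum_gap_le.
Qed.

Lemma cauchy_sum_inv_bound (R : realType) (th : R) (x y a b : R[i]) :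
  x != 0 -> y != 0 -> (forall n, pole x a n != 0) -> (forall n, pole y b n != 0) ->
  (forall n k, pole x a n * pole y b k != 1) ->
  exists B : R, forall L n,
    normc (cauchy_sum (coef th y) (pole y b) L (pole x a n)^-1) <= B.
Proof.
move=> x0 y0 X0 Y0 XY.
have [c c0 hc] := pole_dist x0 X0; have [c' c'0 hc'] := pole_dist y0 Y0.
have hp n : c * n.+1%:R ^+ 2 <= normc (pole x a n) by rewrite -[pole _ _ _]subr0.
have hq n : c' * n.+1%:R ^+ 2 <= normc (pole y b n) by rewrite -[pole _ _ _]subr0.
have [c'' c''0 h] := inv_dist c0 c'0 hp hq XY.
exists (normc (4 / pi%:C * y) / c'' * 2) => L n.
apply: (@normc_cauchy_sum_le _ _ _ _ (fun k => k.+1%:R ^+ 2)) => //.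
- exact: normc_ge0.
- exact: normc_coef.
- exact: sum_inv_sqr_le2.
Qed.

(** One index [i] of one family is treated with a general coefficient [c], so that both halves of
    the identity follow by exchanging the families. *)
Lemma cvg_half_sum (R : realType) (M N : nat) (theta : 'I_M -> R) (beta : 'I_N -> R)
    (a x : 'I_M -> R[i]) (b y : 'I_N -> R[i]) (i : 'I_M) (c : nat -> R[i]) (C : R) :
  (forall j, `|theta j| <= pi / 2) -> (forall j, `|beta j| <= pi / 2) ->
  (forall j, x j != 0) -> (forall j, y j != 0) ->
  (forall j n k, i != j -> pole (x i) (a i) n != pole (x j) (a j) k) ->
  (forall j, i != j -> complex.Im (x i / x j) != 0 \/ x i = x j) ->
  (forall n, pole (x i) (a i) n != 0) -> (forall j n, pole (y j) (b j) n != 0) ->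
  (forall j n k, pole (x i) (a i) n * pole (y j) (b j) k != 1) ->
  (forall n, normc (c n) <= C * (n.+1%:R ^+ 2)^-1) ->
  let l n : R[i]^o := c n *
    (\prod_(j < N) sinh_factor (beta j) (y j) (sqrtC (b j ^+ 2 - 1 / pole (x i) (a i) n))) *
    (\prod_(j < M | j != i) sin_factor (theta j) (x j) (sqrtC (pole (x i) (a i) n - a j ^+ 2))) in
  cvgn (series l) /\
  (\sum_(n < L) c n *
    (\prod_(j < N) cauchy_sum (coef (beta j) (y j)) (pole (y j) (b j)) L (pole (x i) (a i) n)^-1) *
    (\prod_(j < M | j != i)
      cauchy_sum (coef (theta j) (x j)) (pole (x j) (a j)) L (pole (x i) (a i) n)) : R[i]^o)
    @[L --> \oo] --> limn (series l).
Proof.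
move=> hth hbe x0 y0 pp xIm X0 Y0 XY hc.
apply: (cvg_sum_prod hc
  (A := fun j L n => cauchy_sum (coef (beta j) (y j)) (pole (y j) (b j)) L (pole (x i) (a i) n)^-1)
  (B := fun j L n => cauchy_sum (coef (theta j) (x j)) (pole (x j) (a j)) L (pole (x i) (a i) n))).
- by move=> j; apply: cauchy_sum_inv_bound.
- move=> j ji; rewrite eq_sym in ji; apply: cauchy_sum_pole_bound => //.
  + exact: xIm.
  + by move=> n k; exact: pp.
(* Multiplying the square root by i turns its square b^2 - 1/X into 1/X - b^2, the form required of
   the sine factor at w = 1/X. *)
- move=> j n; rewrite sinh_factorE; apply: cvg_cauchy_sum_sin_factor => //.
  + move=> k; apply: contra_neq (XY j n k) => ->; rewrite mulfV //.
  + by rewrite exprMn sqr_i sqrtCK div1r mulN1r opprB.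
- move=> j n ji; apply: cvg_cauchy_sum_sin_factor => //.
  + by move=> k; rewrite eq_sym pp // eq_sym.
  + by rewrite sqrtCK.
Qed.

Lemma normc_osc_div_le (R : realType) (th : R) (d : nat -> R[i]) (c : R) : 0 < c ->
  (forall n, c * n.+1%:R ^+ 2 <= normc (d n)) ->
  forall n, normc ((osc th n)%:C / d n) <= c^-1 * (n.+1%:R ^+ 2)^-1.
Proof.
move=> c0 hd n; rewrite normcM normc_real normcV -[leRHS]mul1r.
apply: ler_pM; rewrite ?invr_ge0 ?normc_ge0 ?osc_le1 //.
by rewrite -invfM lef_pV2 // posrE ?(lt_le_trans _ (hd n)) // mulr_gt0 // exprn_gt0.
Qed.

(** * Assembly of the identity from its two halves *)

Unset Implicit Arguments.
Set Strict Implicit.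

Theorem proposition3 (R : realType) (M N : nat) (hM : (1 <= M)%N) (hN : (1 <= N)%N)
  (theta : 'I_M -> R) (beta : 'I_N -> R)
  (a x : 'I_M -> R[i]) (b y : 'I_N -> R[i]) (t : R[i])
  (htheta : forall i, `|theta i| <= pi / 2)
  (hbeta : forall i, `|beta i| <= pi / 2)
  (hx0 : forall i, x i != 0)
  (hy0 : forall i, y i != 0)
  (hxa : forall n k : nat, odd n -> odd k -> forall i j : 'I_M, i != j ->
     x i ^+ 2 * n%:R ^+ 2 - x j ^+ 2 * k%:R ^+ 2 != a j ^+ 2 - a i ^+ 2)
  (hyb : forall n k : nat, odd n -> odd k -> forall i j : 'I_N, i != j ->
     y i ^+ 2 * n%:R ^+ 2 - y j ^+ 2 * k%:R ^+ 2 != b j ^+ 2 - b i ^+ 2)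
  (hxIm : forall i j : 'I_M, i != j -> complex.Im (x i / x j) != 0 \/ x i = x j)
  (hyIm : forall i j : 'I_N, i != j -> complex.Im (y i / y j) != 0 \/ y i = y j)
  (ht0 : t != 0)
  (hX0 : forall (n : nat) i, odd n -> x i ^+ 2 * n%:R ^+ 2 + a i ^+ 2 != 0)
  (hY0 : forall (n : nat) j, odd n -> y j ^+ 2 * n%:R ^+ 2 + b j ^+ 2 != 0)
  (hXt : forall (n : nat) i, odd n -> x i ^+ 2 * n%:R ^+ 2 + a i ^+ 2 != t ^+ 2)
  (hYt : forall (n : nat) j, odd n -> y j ^+ 2 * n%:R ^+ 2 + b j ^+ 2 != t ^- 2)
  (hXY : forall (n k : nat) i j, odd n -> odd k ->
     (x i ^+ 2 * n%:R ^+ 2 + a i ^+ 2) * (y j ^+ 2 * k%:R ^+ 2 + b j ^+ 2) != 1) :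
  let X (i : 'I_M) (n : nat) : R[i] := (2 * n + 1)%:R ^+ 2 * x i ^+ 2 + a i ^+ 2 in
  let Y (i : 'I_N) (n : nat) : R[i] := (2 * n + 1)%:R ^+ 2 * y i ^+ 2 + b i ^+ 2 in
  let u (i : 'I_M) (n : nat) : R[i]^o :=
    (-1) ^+ n * (sin ((2 * n + 1)%:R * theta i))%:C / (X i n - t ^+ 2)
    * (\prod_(j < N) sinh_factor (beta j) (y j) (sqrtC (b j ^+ 2 - 1 / X i n)))
    * (\prod_(j < M | j != i) sin_factor (theta j) (x j) (sqrtC (X i n - a j ^+ 2))) in
  let v (i : 'I_N) (n : nat) : R[i]^o :=
    (-1) ^+ n * (sin ((2 * n + 1)%:R * beta i))%:C / (Y i n * (Y i n * t ^+ 2 - 1))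
    * (\prod_(j < M) sinh_factor (theta j) (x j) (sqrtC (a j ^+ 2 - 1 / Y i n)))
    * (\prod_(j < N | j != i) sin_factor (beta j) (y j) (sqrtC (Y i n - b j ^+ 2))) in
  [/\ forall i, cvgn (series (u i)),
      forall i, cvgn (series (v i)) &
      \sum_(i < M) x i * limn (series (u i)) + \sum_(i < N) y i * limn (series (v i))
      = pi%:C / 4
        * (\prod_(i < M) sin_factor (theta i) (x i) (sqrtC (t ^+ 2 - a i ^+ 2)))
        * (\prod_(i < N) sinh_factor (beta i) (y i) (sqrtC (b i ^+ 2 - 1 / t ^+ 2)))].
Proof.
move=> X Y u v.
have p0 := pi_gt0 R.
have pC : pi%:C != 0 :> R[i] by rewrite (inj_eq (@complexI R) _ 0) gt_eqF.
have poleE (z c : R[i]) n : pole z c n = z ^+ 2 * (2 * n + 1)%:R ^+ 2 + c ^+ 2.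
  by rewrite /pole mulrC.
have oddn n : odd (2 * n + 1) by rewrite oddD oddM.
have pX0 i n : pole (x i) (a i) n != 0 by rewrite poleE hX0.
have pY0 i n : pole (y i) (b i) n != 0 by rewrite poleE hY0.
have pXt i n : pole (x i) (a i) n != t ^+ 2 by rewrite poleE hXt.
have pYt i n : pole (y i) (b i) n != (t ^+ 2)^-1 by rewrite poleE hYt.
have pXY i j n k : pole (x i) (a i) n * pole (y j) (b j) k != 1 by rewrite !poleE hXY.
have ppX i j n k : i != j -> pole (x i) (a i) n != pole (x j) (a j) k.
  move=> ij; apply: contra_neq (hxa _ _ (oddn n) (oddn k) i j ij).
  rewrite !poleE => /(canRL (addrK _)) ->; ring.
have ppY i j n k : i != j -> pole (y i) (b i) n != pole (y j) (b j) k.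
  move=> ij; apply: contra_neq (hyb _ _ (oddn n) (oddn k) i j ij).
  rewrite !poleE => /(canRL (addrK _)) ->; ring.
have t20 : t ^+ 2 != 0 by rewrite expf_neq0.
have oscE (th : R) n : (osc th n)%:C = (-1) ^+ n * (sin ((2 * n + 1)%:R * th))%:C.
  by rewrite /osc rmorphM rmorphXn rmorphN rmorph1.
pose cu i n := (osc (theta i) n)%:C / (pole (x i) (a i) n - t ^+ 2).
pose cv i n := (osc (beta i) n)%:C /
  (pole (y i) (b i) n * (pole (y i) (b i) n * t ^+ 2 - 1)).
have hu i : cvgn (series (u i)) /\ (\sum_(n < L) cu i n *
    (\prod_(j < N) cauchy_sum (coef (beta j) (y j)) (pole (y j) (b j)) L (pole (x i) (a i) n)^-1) *
    (\prod_(j < M | j != i)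
      cauchy_sum (coef (theta j) (x j)) (pole (x j) (a j)) L (pole (x i) (a i) n)) : R[i]^o)
    @[L --> \oo] --> limn (series (u i)).
  have [c c0 hc] := pole_dist (hx0 i) (pXt i).
  have := cvg_half_sum htheta hbeta hx0 hy0 (fun j n k => @ppX i j n k) (@hxIm i)
    (pX0 i) pY0 (fun j n k => pXY i j n k) (normc_osc_div_le (theta i) c0 hc).
  rewrite /= (_ : (fun n => _) = u i) //.
  by apply/funext => n; rewrite /u oscE.
have hv i : cvgn (series (v i)) /\ (\sum_(n < L) cv i n *
    (\prod_(j < M) cauchy_sum (coef (theta j) (x j)) (pole (x j) (a j)) L (pole (y i) (b i) n)^-1) *
    (\prod_(j < N | j != i)
      cauchy_sum (coef (beta j) (y j)) (pole (y j) (b j)) L (pole (y i) (b i) n)) : R[i]^o)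
    @[L --> \oo] --> limn (series (v i)).
  have [c c0 hc] := pole_dist (hy0 i) (pY0 i).
  have [c' c'0 hc'] := pole_dist (hy0 i) (pYt i).
  have T0 : 0 < normc (t ^+ 2) by rewrite normc_gt0.
  (* The denominator is t^2 Y (Y - t^-2): the factor Y supplies (n+1)^2, and from Y - t^-2 only the
     lower bound c' is kept. *)
  have C0 : 0 < c * (normc (t ^+ 2) * c') by rewrite !mulr_gt0.
  have hC n : c * (normc (t ^+ 2) * c') * n.+1%:R ^+ 2 <=
      normc (pole (y i) (b i) n * (pole (y i) (b i) n * t ^+ 2 - 1)).
    have -> : pole (y i) (b i) n * t ^+ 2 - 1 = t ^+ 2 * (pole (y i) (b i) n - (t ^+ 2)^-1).
      by field; exact: ht0.
    rewrite normcM [normc (t ^+ 2 * _)]normcM mulrAC; apply: ler_pM.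
    + by rewrite mulr_ge0 ?sqr_ge0 // ltW.
    + by rewrite mulr_ge0 ?normc_ge0 // ltW.
    + by have := hc n; rewrite subr0.
    + rewrite ler_wpM2l ?(ltW T0) //; apply: le_trans (hc' n).
      by rewrite ler_peMr ?(ltW c'0) // exprn_ege1 // ler1n.
  have := cvg_half_sum hbeta htheta hy0 hx0 (fun j n k => @ppY i j n k) (@hyIm i)
    (pY0 i) pX0 (fun j n k => _) (normc_osc_div_le (beta i) C0 hC).
  rewrite /= (_ : (fun n => _) = v i) // => [h|]; last first.
    by apply/funext => n; rewrite /v oscE.
  by apply: h => j n k; rewrite mulrC.
split=> [i|i|]; [exact: (hu i).1|exact: (hv i).1|].
(* The truncated right-hand side, without pi/4, converges factor by factor. *)
have hL : ((\prod_(i < M) cauchy_sum (coef (theta i) (x i)) (pole (x i) (a i)) L (t ^+ 2)) *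
    (\prod_(j < N) cauchy_sum (coef (beta j) (y j)) (pole (y j) (b j)) L (t ^+ 2)^-1) : R[i]^o)
    @[L --> \oo] -->
    ((\prod_(i < M) sin_factor (theta i) (x i) (sqrtC (t ^+ 2 - a i ^+ 2))) *
     (\prod_(i < N) sinh_factor (beta i) (y i) (sqrtC (b i ^+ 2 - 1 / t ^+ 2))) : R[i]^o).
  apply: cvgM; apply: cvg_prod_cond => j _.
    by apply: cvg_cauchy_sum_sin_factor => //; rewrite sqrtCK.
  rewrite sinh_factorE; apply: cvg_cauchy_sum_sin_factor => //.
  by rewrite exprMn sqr_i sqrtCK div1r mulN1r opprB.
have hR : ((\sum_(i < M) 4 / pi%:C * x i * (\sum_(n < L) cu i n *
    (\prod_(j < N) cauchy_sum (coef (beta j) (y j)) (pole (y j) (b j)) L (pole (x i) (a i) n)^-1) *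
    (\prod_(j < M | j != i)
      cauchy_sum (coef (theta j) (x j)) (pole (x j) (a j)) L (pole (x i) (a i) n)))) +
    (\sum_(i < N) 4 / pi%:C * y i * (\sum_(n < L) cv i n *
    (\prod_(j < M) cauchy_sum (coef (theta j) (x j)) (pole (x j) (a j)) L (pole (y i) (b i) n)^-1) *
    (\prod_(j < N | j != i)
      cauchy_sum (coef (beta j) (y j)) (pole (y j) (b j)) L (pole (y i) (b i) n)))) : R[i]^o)
    @[L --> \oo] -->
    ((\sum_(i < M) 4 / pi%:C * x i * limn (series (u i))) +
     (\sum_(i < N) 4 / pi%:C * y i * limn (series (v i))) : R[i]^o).
  apply: cvgD; (apply: cvg_big => [|i _]; first exact: add_continuous);
    apply: cvgM; try exact: cvg_cst.
  - exact: (hu i).2.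
  - exact: (hv i).2.
(* By [mul_prod_cauchy_sum] at w = t^2 the two sequences coincide at every [L], so their limits
   agree. *)
have E := cvg_near_unique hL hR; rewrite -mulrA E; last first.
  apply: nearW => L; rewrite mul_prod_cauchy_sum //.
  congr (_ + _); apply: eq_bigr => i _; rewrite mulr_sumr; apply: eq_bigr => n _.
  - by rewrite /cu /coef !mulrA.
  - by rewrite /cv /coef !mulrA.
(* The factor pi/4 cancels the 4/pi contributed by [coef]. *)
rewrite mulrDr !mulr_sumr.
by congr (_ + _); apply: eq_bigr => i _; move: pi%:C pC => p pC; field.
Qed.
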